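(* Let $p>1$, let $\mathcal G$ be a connected metric graph with $|\mathcal E_{\mathrm{inf}}|>0$, and let $\mathrm H$ be a self-adjoint Hamiltonian on $\mathcal G$ with $l_{\mathrm H}<0$. Assume that $\tau_{\min}$ admits a minimizer (in $\mathcal D(Q_{\mathrm H})$). Then there exists $\mu_2\ge\mu_{\min}$ such that $\tau_{\min}$ does not admit any minimizer of mass $\mu$ for any $\mu>\mu_2$.
   Context: Metric graph: $\mathcal G$ has a finite vertex set $\mathcal V$ and a finite edge set $\mathcal E=\mathcal E_{\mathrm{fin}}\cup\mathcal E_{\mathrm{inf}}$. Each $e\in\mathcal E_{\mathrm{fin}}$ is identified with $I_e=[0,L_e]$, $0<L_e<\infty$, with both endpoints attached to vertices; each $e\in\mathcal E_{\mathrm{inf}}$ is identified with $I_e=[0,\infty)$, with $0$ attached to a vertex. $\mathcal G$ is connected. A function $\psi=(\psi_e)_{e\in\mathcal E}$ on $\mathcal G$ is a collection of functions $\psi_e:I_e\to\mathbb C$. $L^q(\mathcal G)=\bigoplus_e L^q(I_e)$ and $H^k(\mathcal G)=\bigoplus_e H^k(I_e)$ (edgewise, no vertex conditions imposed), with the natural norms. Hamiltonian: for $v\in\mathcal V$ of degree $d_v$, $\Psi(v)\in\mathbb C^{d_v}$ is the vector of the values at $v$ of $\psi$ along the edges adjacent to $v$, and $\Psi'(v)\in\mathbb C^{d_v}$ the vector of derivatives at $v$ in the direction going out of $v$ into the edges. For each $v$ there are mutually orthogonal orthogonal projectors $P_{D,v},P_{N,v},P_{R,v}$ on $\mathbb C^{d_v}$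 with $P_{D,v}+P_{N,v}+P_{R,v}=I$, and an invertible Hermitian operator $\Lambda_v$ on $P_{R,v}\mathbb C^{d_v}$. The self-adjoint operator $\mathrm H$ is $\mathrm H\psi=(-\psi_e'')_e$ with domain $\{\psi\in H^2(\mathcal G): P_{D,v}\Psi(v)=0,\ P_{N,v}\Psi'(v)=0,\ P_{R,v}\Psi'(v)=\Lambda_vP_{R,v}\Psi(v)\ \forall v\in\mathcal V\}$. Its quadratic form is $Q_{\mathrm H}(\psi)=\|\psi'\|_{L^2(\mathcal G)}^2+\sum_{v}\langle\Lambda_vP_{R,v}\Psi(v),P_{R,v}\Psi(v)\rangle_{\mathbb C^{d_v}}$ on $\mathcal D(Q_{\mathrm H})=\{\psi\in H^1(\mathcal G):P_{D,v}\Psi(v)=0\ \forall v\}$. Set $l_{\mathrm H}=\inf\{Q_{\mathrm H}(\psi):\psi\in\mathcal D(Q_{\mathrm H}),\ \|\psi\|_{L^2(\mathcal G)}=1\}$. Energy: $E_{\mathrm H}(\psi)=\frac12Q_{\mathrm H}(\psi)+\frac1{p+1}\|\psi\|_{L^{p+1}(\mathcal G)}^{p+1}$; $\tau_\mu=\inf\{E_{\mathrm H}(\psi):\psi\in\mathcal D(Q_{\mathrm H}),\ \|\psi\|_{L^2(\mathcal G)}=\mu\}$ for $\mu>0$; $\tau_{\min}=\inf\{E_{\mathrm H}(\psi):\psi\in\mathcal D(Q_{\mathrm H})\}$. The mass of $\psi$ is $\|\psi\|_{L^2(\mathcal G)}$. $\mu_{\min}\in(0,\infty]$ is $\min\{\mu>0:\tau_\mu=\tau_{\min}\}$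 if $\mu\mapsto\tau_\mu$ admits a minimum, and $\infty$ otherwise. *)

(* Defs.v *)
From HB Require Import structures.
From mathcomp Require Import all_boot all_order all_algebra.
From mathcomp Require Import complex.
From mathcomp Require Import all_classical all_reals all_analysis.
Import Order.TTheory GRing.Theory Num.Theory.
Import numFieldNormedType.Exports.
Import ComplexField.Normc.

Set Implicit Arguments.
Unset Strict Implicit.
Unset Printing Implicit Defensive.

Local Open Scope classical_set_scope.
Local Open Scope ring_scope.
Local Open Scope complex_scope.
Local Open Scope sesquilinear_scope.

(* Loops and multiple edges are allowed. A finite edge e is [0, edge_length e],
   with 0 attached to edge_src e and edge_length e attached to edge_tgt e; an
   infinite edge is [0, +oo[, with 0 attached to edge_root e. *)
Record metric_graph (R : realType) := MetricGraph {
  vertex : finType;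
  fin_edge : finType;
  inf_edge : finType;
  edge_length : fin_edge -> R;
  edge_src : fin_edge -> vertex;
  edge_tgt : fin_edge -> vertex;
  edge_root : inf_edge -> vertex;
  edge_length_gt0 : forall e, 0 < edge_length e }.

Section Graph.
Variables (R : realType) (G : metric_graph R).

Definition edge : finType := (fin_edge G + inf_edge G)%type.

Definition edge_itv (e : edge) : set R :=
  match e with
  | inl e => `[0, edge_length e]
  | inr _ => `[0, +oo[
  end.

Definition adjacent (u v : vertex G) : bool :=
  [exists e : fin_edge G,
     ((edge_src e == u) && (edge_tgt e == v)) ||
     ((edge_src e == v) && (edge_tgt e == u))].

Definition connected_graph : Prop :=
  forall u v : vertex G, connect adjacent u v.

(* inl (e, false) and inl (e, true) are the ends 0 and edge_length e of the
   finite edge e; a loop thus counts twice in the degree of its vertex. *)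
Definition edge_end : finType := ((fin_edge G * bool) + inf_edge G)%type.

Definition end_vertex (h : edge_end) : vertex G :=
  match h with
  | inl (e, false) => edge_src e
  | inl (e, true) => edge_tgt e
  | inr e => edge_root e
  end.

Definition ends_at (v : vertex G) : {set edge_end} :=
  [set h | end_vertex h == v]%SET.

Definition degree (v : vertex G) : nat := #|ends_at v|.

(* Only the values of psi e on edge_itv e are relevant. *)
Definition graph_fun := edge -> R -> R[i].

Definition end_value (psi : graph_fun) (h : edge_end) : R[i] :=
  match h with
  | inl (e, false) => psi (inl e) 0
  | inl (e, true) => psi (inl e) (edge_length e)
  | inr e => psi (inr e) 0
  end.

Definition vertex_values (psi : graph_fun) (v : vertex G) :
    'cV[R[i]]_(degree v) :=
  \col_(i < degree v) end_value psi (enum_val i).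

End Graph.

Section Sobolev.
Variable R : realType.
Local Notation mu := (@lebesgue_measure R).
Local Notation Re := (@complex.Re R).
Local Notation Im := (@complex.Im R).

Definition in_L2 (I : set R) (f : R -> R[i]) : Prop :=
  [/\ measurable_fun I (Re \o f), measurable_fun I (Im \o f) &
      (\int[mu]_(x in I) (normc (f x) `^ 2)%:E < +oo)%E].

Definition C1_compact_support (I : set R) (phi : R -> R) : Prop :=
  [/\ forall x, derivable phi x 1,
      continuous (derive1 phi) &
      exists K : set R,
        [/\ compact K, K `<=` I° & forall x, ~ K x -> phi x = 0]].

(* Integration by parts against real-valued test functions, separately for
   real and imaginary parts. *)
Definition is_weak_deriv (I : set R) (f g : R -> R[i]) : Prop :=
  forall phi : R -> R, C1_compact_support I phi ->
    Rintegral mu I (fun x => Re (f x) * derive1 phi x) =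
      - Rintegral mu I (fun x => Re (g x) * phi x) /\
    Rintegral mu I (fun x => Im (f x) * derive1 phi x) =
      - Rintegral mu I (fun x => Im (g x) * phi x).

(* An element of H^1(I) is given by its representative continuous on I, so
   that its values at the endpoints of I are plain evaluations. *)
Definition in_H1 (I : set R) (f : R -> R[i]) : Prop :=
  [/\ {within I, continuous (Re \o f)}, {within I, continuous (Im \o f)},
      in_L2 I f &
      exists g, in_L2 I g /\ is_weak_deriv I f g].

(* Unique up to equality almost everywhere on I when f is in H^1(I). *)
Definition weak_deriv (I : set R) (f : R -> R[i]) : R -> R[i] :=
  xget (fun=> 0) [set g | in_L2 I g /\ is_weak_deriv I f g].

End Sobolev.

Section GraphNorms.
Variables (R : realType) (G : metric_graph R).

Definition in_H1_graph (psi : graph_fun G) : Prop :=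
  forall e, in_H1 (edge_itv e) (psi e).

Definition graph_deriv (psi : graph_fun G) : graph_fun G :=
  fun e => weak_deriv (edge_itv e) (psi e).

Definition Lq_norm (q : R) (psi : graph_fun G) : \bar R :=
  ((\sum_(e : edge G)
     \int[@lebesgue_measure R]_(x in edge_itv e) (normc (psi e x) `^ q)%:E)
   `^ q^-1)%E.

Definition mass (psi : graph_fun G) : \bar R := Lq_norm 2 psi.

End GraphNorms.

Definition is_orthogonal_projector (R : realType) (n : nat)
    (P : 'M[R[i]]_n) : Prop :=
  P *m P = P /\ P ^t* = P.

(* vc_Lambda v is the operator on the range of vc_PR v, extended by 0 to the
   orthogonal complement of that range. *)
Record vertex_conditions (R : realType) (G : metric_graph R) :=
  VertexConditions {
  vc_PD : forall v : vertex G, 'M[R[i]]_(degree v);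
  vc_PN : forall v : vertex G, 'M[R[i]]_(degree v);
  vc_PR : forall v : vertex G, 'M[R[i]]_(degree v);
  vc_Lambda : forall v : vertex G, 'M[R[i]]_(degree v);
  vc_PD_proj : forall v, is_orthogonal_projector (vc_PD v);
  vc_PN_proj : forall v, is_orthogonal_projector (vc_PN v);
  vc_PR_proj : forall v, is_orthogonal_projector (vc_PR v);
  vc_PD_PN : forall v, vc_PD v *m vc_PN v = 0;
  vc_PD_PR : forall v, vc_PD v *m vc_PR v = 0;
  vc_PN_PR : forall v, vc_PN v *m vc_PR v = 0;
  vc_sum : forall v, vc_PD v + vc_PN v + vc_PR v = 1%:M;
  vc_Lambda_range : forall v, vc_PR v *m vc_Lambda v *m vc_PR v = vc_Lambda v;
  vc_Lambda_herm : forall v, (vc_Lambda v) ^t* = vc_Lambda v;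
  vc_Lambda_inv : forall v, exists M : 'M[R[i]]_(degree v),
    [/\ vc_PR v *m M *m vc_PR v = M,
        vc_Lambda v *m M = vc_PR v & M *m vc_Lambda v = vc_PR v] }.

Section Hamiltonian.
Variables (R : realType) (G : metric_graph R) (H : vertex_conditions G).

Definition form_domain : set (graph_fun G) :=
  [set psi | in_H1_graph psi /\
             forall v, vc_PD H v *m vertex_values psi v = 0].

(* <Lambda P_R Psi(v), P_R Psi(v)>, which is real since Lambda is Hermitian. *)
Definition vertex_form (psi : graph_fun G) (v : vertex G) : R :=
  let w := vc_PR H v *m vertex_values psi v in
  complex.Re ((w ^t* *m (vc_Lambda H v *m w)) 0 0).

Definition quad_form (psi : graph_fun G) : \bar R :=
  (Lq_norm 2 (graph_deriv psi) ^+ 2 +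
   (\sum_(v : vertex G) vertex_form psi v)%:E)%E.

Definition l_H : \bar R :=
  ereal_inf [set quad_form psi | psi in
               form_domain `&` [set psi | mass psi = 1%E]].

Variable p : R.

Definition energy (psi : graph_fun G) : \bar R :=
  ((2^-1)%:E * quad_form psi +
   ((p + 1)^-1)%:E * Lq_norm (p + 1) psi `^ (p + 1))%E.

Definition tau (mu : R) : \bar R :=
  ereal_inf [set energy psi | psi in
               form_domain `&` [set psi | mass psi = mu%:E]].

Definition tau_min : \bar R :=
  ereal_inf [set energy psi | psi in form_domain].

Definition tau_has_min : Prop :=
  exists2 mu0 : R, 0 < mu0 & forall mu : R, 0 < mu -> (tau mu0 <= tau mu)%E.

(* The smallest mu > 0 with tau mu = tau_min. *)
Definition mu_min : \bar R :=
  if `[< tau_has_min >] then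
    ereal_inf [set mu%:E | mu in [set mu : R | 0 < mu /\ tau mu = tau_min]]
  else +oo%E.

Definition tau_min_minimizer (psi : graph_fun G) : Prop :=
  form_domain psi /\ energy psi = tau_min.

End Hamiltonian.

(* Main.v *)
From HB Require Import structures.
Require Import Defs.
From mathcomp Require Import all_boot all_order all_algebra.
From mathcomp Require Import complex.
From mathcomp Require Import all_classical all_reals all_analysis.
From mathcomp Require Import measurable_realfun.
From mathcomp Require Import ring lra.
Import Order.TTheory GRing.Theory Num.Theory.
Import numFieldNormedType.Exports.
Import ComplexField.Normc.

Set Implicit Arguments.
Unset Strict Implicit.
Unset Printing Implicit Defensive.

Local Open Scope classical_set_scope.
Local Open Scope ring_scope.
Local Open Scope complex_scope.

(** A minimizer psi of the energy has bounded mass because its L^(p+1) norm is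
    bounded and because its restriction to an infinite edge is, up to phase and
    translation, one and the same universal profile.

    Bound on the L^(p+1) norm. Write A for the quadratic form and B for
    the (p+1)-th power of the L^(p+1) norm, so that the energy of t psi is
    t^2 A / 2 + t^(p+1) B / (p+1). Comparing psi with psi / 2 bounds B in terms of
    p and tau_min ([minimizer_Lint_bound]). On a finite edge of length L this
    bounds the square of the L^2 norm by L + B, since s^2 <= 1 + s^(p+1).

    Infinite edges. Changing psi on one infinite edge without changing its value
    at the vertex cannot lower the energy, so that psi minimizes there the convex
    functional J(f) = |f'|^2 / 2 + |f|^(p+1) / (p+1), integrated over the half
    line, among the functions of H^1 with the same value at 0
    ([half_minimizer], [minimizer_half]). Three facts replace the
    explicit solution of the Euler-Lagrange equation:
    - strict convexity makes the minimizer unique given f 0, hence, up to phase,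
      given |f 0| ([half_minimizer_unique]);
    - a translate of a minimizer is a minimizer ([half_minimizer_shift]), because
      a perturbation of the tail vanishing at its end point can be extended by 0;
    - the modulus of a function of H^1 starting above a level d > 0 reaches d
      ([first_hit]).
    Fix a minimizer f1 with d = |f1 0| > 0; if there is none, all minimizers are 0.
    If 0 < |f 0| <= d then |f| is a tail of |f1|, so that its L^2 norm is at most
    that of f1. If |f 0| > d, let a be the first point where |f| equals d: after
    a, |f| is a translate of |f1|, and before a one has |f| >= d, whence
    |f|^2 <= d^(1-p) |f|^(p+1), whose integral is at most d^(1-p) B. This is [half_minimizer_mass]; it makes no distinction
    between the values of p for which such profiles exist in L^2 and the others.

    Finiteness of mu_min. The assumption l_H < 0 gives tau_min < 0
    ([tau_min_lt0]): a function on which the quadratic form is negative can be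
    replaced on the infinite edges by flat functions of compact support with the
    same vertex values, and then multiplied by a small number. On multiples
    of a function of mass 0 the energy is quadratic, so it cannot have a negative
    minimum there; hence a minimizer has positive mass ([minimizer_mass_gt0]), and
    its mass is at least mu_min.

    The energy of a modified function is computed with the weak derivative
    produced by the modification; this is legitimate since weak derivatives are
    unique almost everywhere ([weak_unique]). *)

(* Fixing the measure first makes unification pick the measurable structure of
   the Lebesgue measure rather than the default one on the reals. *)
Local Notation muD := (@integrableD _ _ _ (@lebesgue_measure _) _).
Local Notation muZ := (@integrableZl _ _ _ (@lebesgue_measure _) _).
Local Notation mu_eq mI :=
  (@eq_integrable _ _ _ (@lebesgue_measure _) _ mI _ _).
Local Notation muS := (@integrableS _ _ _ (@lebesgue_measure _) _ _).

(** * A cutoff of class C^1 *)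

Section Smooth.
Variable R : realType.
Implicit Types (f g phi : R -> R) (x y a b : R).
Local Notation mu := (@lebesgue_measure R).

Definition C1 f := (forall x, derivable f x 1) /\ continuous (derive1 f).

Definition pos_square x : R := Num.max 0 x ^+ 2.

(** The derivative is 2-Lipschitz, so the Taylor remainder is quadratic; this
    covers the kink at 0 together with the other points. *)
Lemma pos_square_taylor x h :
  `|pos_square (x + h) - pos_square x - h * (2 * Num.max 0 x)| <= h ^+ 2.
Proof.
rewrite /pos_square ler_norml /Num.max.
by case: ifPn; case: ifPn; rewrite -?leNgt => *; apply/andP; split; nra.
Qed.

Lemma is_derive_pos_square x : is_derive x (1:R) pos_square (2 * Num.max 0 x).
Proof.
have H : h^-1 *: (pos_square (h + x) - pos_square x) @[h --> 0^'] --> 2 * Num.max 0 x.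
  apply/cvgrPdist_le => e e0; near=> h.
  have h0 : h != 0 by near: h; exact: nbhs_dnbhs_neq.
  have -> : 2 * Num.max 0 x - h^-1 *: (pos_square (h + x) - pos_square x)
    = - (h^-1 * (pos_square (x + h) - pos_square x - h * (2 * Num.max 0 x))).
    by rewrite (addrC h) /GRing.scale /=; field.
  rewrite normrN normrM normfV.
  rewrite ler_pdivrMl ?normr_gt0//.
  apply: (le_trans (pos_square_taylor _ _)).
  rewrite -(real_normK (num_real h)) expr2 ler_pM2l ?normr_gt0//.
  near: h. exact: dnbhs0_le.
split.
  apply/cvg_ex; exists (2 * Num.max 0 x).
  apply: cvg_trans H; apply: near_eq_cvg; near=> h.
  by rewrite /= -[h *: 1]/(h * 1) mulr1.
apply/cvg_lim => //.
apply: cvg_trans H; apply: near_eq_cvg; near=> h.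
by rewrite /= -[h *: 1]/(h * 1) mulr1.
Unshelve. all: by end_near.
Qed.

(** A primitive of a tent of height 2 on the unit interval: it rises from 0 to
    1 and is of class C^1, which is all that test functions require. *)
Definition smoothstep x : R :=
  2 * pos_square x - 4 * pos_square (x - 2^-1) + 2 * pos_square (x - 1).

Definition smoothstep' x : R :=
  4 * Num.max 0 x - 8 * Num.max 0 (x - 2^-1) + 4 * Num.max 0 (x - 1).

Lemma is_derive_pos_square_shift x a :
  is_derive x (1:R) (fun y => pos_square (y - a)) (2 * Num.max 0 (x - a)).
Proof.
have := @is_derive1_comp R (pos_square) (fun y => y - a) x (2 * Num.max 0 (x - a)) 1 (is_derive_pos_square _).
have D : is_derive x 1 (fun y : R => y - a) 1.
  rewrite -[X in is_derive _ _ _ X]subr0; apply: is_deriveB.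
by move=> /(_ D); rewrite mulr1.
Qed.

Lemma is_derive_smoothstep x : is_derive x (1:R) smoothstep (smoothstep' x).
Proof.
have D1 := is_derive_pos_square x.
have D2 := is_derive_pos_square_shift x 2^-1.
have D3 := is_derive_pos_square_shift x 1.
rewrite /smoothstep /smoothstep'.
have -> : 4 * Num.max 0 x - 8 * Num.max 0 (x - 2^-1) + 4 * Num.max 0 (x - 1) =
  2 *: (2 * Num.max 0 x) - 4 *: (2 * Num.max 0 (x - 2^-1)) + 2 *: (2 * Num.max 0 (x - 1)).
  by rewrite /GRing.scale /=; ring.
by apply: is_deriveD; apply: is_deriveB.
Qed.

Lemma smoothstep_le0 x : x <= 0 -> smoothstep x = 0.
Proof.
move=> x0; rewrite /smoothstep /pos_square !max_l; lra.
Qed.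

Lemma smoothstep_ge1 x : 1 <= x -> smoothstep x = 1.
Proof.
by move=> x0; rewrite /smoothstep /pos_square !max_r; lra.
Qed.

Lemma smoothstep_bound x : 0 <= smoothstep x <= 1.
Proof.
rewrite /smoothstep /pos_square /Num.max.
by case: ifPn; case: ifPn; case: ifPn; rewrite -?leNgt => *; apply/andP; split; nra.
Qed.

Lemma smoothstep'_bound x : `|smoothstep' x| <= 2.
Proof.
rewrite /smoothstep' /Num.max ler_norml.
by case: ifPn; case: ifPn; case: ifPn; rewrite -?leNgt => *; apply/andP; split; lra.
Qed.

Lemma smoothstep'_out x : x <= 0 \/ 1 <= x -> smoothstep' x = 0.
Proof.
rewrite /smoothstep' /Num.max.
by case: ifPn; case: ifPn; case: ifPn; rewrite -?leNgt => ? ? ? []; lra.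
Qed.

Lemma continuous_smoothstep' : continuous smoothstep'.
Proof.
have M0 : continuous (fun x : R => Num.max 0 x).
  by move=> x; apply: (@continuous_max R R (cst 0) id); [exact: cvg_cst|exact: cvg_id].
have M a : continuous (fun x : R => Num.max 0 (x - a)).
  move=> x; apply: (@continuous_max R R (cst 0) (fun x => x - a)).
    exact: cvg_cst.
  by apply: cvgB; [exact: cvg_id|exact: cvg_cst].
move=> x.
apply: cvgD; last by apply: cvgM; [exact: cvg_cst|exact: M].
apply: cvgB.
  apply: cvgM; first exact: cvg_cst.
  exact: M0.
by apply: cvgM; [exact: cvg_cst|exact: M].
Qed.

Lemma C1_is_derive f f' : (forall x, is_derive x 1 f (f' x)) -> continuous f' ->
  C1 f /\ derive1 f = f'.
Proof.
move=> D c; have E : derive1 f = f'.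
  by apply/funext => x; rewrite derive1E; have [_ ->] := D x.
by split => //; split; [move=> x; have [] := D x|rewrite E].
Qed.

Lemma C1_continuous f : C1 f -> continuous f.
Proof. by move=> [d _] x; apply: differentiable_continuous; apply/derivable1_diffP. Qed.

Lemma C1_smoothstep a b : C1 (fun x => smoothstep (a * x + b)) /\
  derive1 (fun x => smoothstep (a * x + b)) = (fun x => smoothstep' (a * x + b) * a).
Proof.
apply: C1_is_derive.
  move=> x; apply: (@is_derive1_comp R smoothstep (fun x => a * x + b) x _ a).
    exact: is_derive_smoothstep.
  rewrite -[X in is_derive _ _ _ X]addr0 -[X in is_derive _ _ _ (X + _)]mulr1.
  by apply: is_deriveD; rewrite -[_ * _]/(_ *: _).
move=> x; apply: cvgM; last exact: cvg_cst.
apply: (@continuous_comp _ _ _ (fun x => a * x + b) smoothstep').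
  apply: cvgD; last exact: cvg_cst.
  by apply: cvgM => //; exact: cvg_cst.
exact: continuous_smoothstep'.
Qed.

Lemma C1M f g : C1 f -> C1 g -> C1 (fun x => f x * g x) /\
  derive1 (fun x => f x * g x) = (fun x => f x * derive1 g x + derive1 f x * g x).
Proof.
move=> cf cg; apply: C1_is_derive.
  move=> x.
  have Df : is_derive x 1 f (derive1 f x) by split; [exact: cf.1|rewrite derive1E].
  have Dg : is_derive x 1 g (derive1 g x) by split; [exact: cg.1|rewrite derive1E].
  have := is_deriveM Df Dg.
  rewrite /GRing.scale /= => H.
  by rewrite [X in is_derive _ _ _ (_ + X)]mulrC.
move=> x; apply: cvgD; apply: cvgM.
- exact: C1_continuous.
- exact: cg.2.
- exact: cf.2.
- exact: C1_continuous.
Qed.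

Lemma C1_shift f a : C1 f -> C1 (fun x => f (x + a)) /\
  derive1 (fun x => f (x + a)) = (fun x => derive1 f (x + a)).
Proof.
move=> cf; apply: C1_is_derive.
  move=> x.
  have Df : is_derive (x + a) 1 f (derive1 f (x + a)) by split; [exact: cf.1|rewrite derive1E].
  have D : is_derive x 1 (fun y : R => y + a) 1.
    rewrite -[X in is_derive _ _ _ X]addr0; apply: is_deriveD.
  by rewrite -[X in is_derive _ _ _ X]mulr1; apply: is_derive1_comp.
move=> x; apply: (@continuous_comp _ _ _ (fun x => x + a) (derive1 f)).
  by apply: cvgD => //; exact: cvg_cst.
exact: cf.2.
Qed.

Lemma C1_FTC f a b : C1 f -> a <= b ->
  Rintegral mu `[a, b] (derive1 f) = f b - f a.
Proof.
move=> cf; rewrite le_eqVlt => /predU1P[->|ab].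
  by rewrite set_itv1 Rintegral_set1 subrr.
rewrite /Rintegral (continuous_FTC2 (F := f) ab) //.
- exact/continuous_subspaceT/cf.2.
- split; first by move=> x _; exact: cf.1.
  + exact/cvg_at_right_filter/C1_continuous.
  + exact/cvg_at_left_filter/C1_continuous.
Qed.

End Smooth.

(** * Square integrability, test functions and weak derivatives *)

Section Weak.
Variable R : realType.
Implicit Types (f g h phi : R -> R) (x y a b M : R) (I J : set R).
Local Notation mu := (@lebesgue_measure R).

Definition L2 I f :=
  measurable_fun I f /\ mu.-integrable I (EFin \o (fun x => f x ^+ 2)).

Definition weak_real I f g := forall phi, C1_compact_support I phi ->
  Rintegral mu I (fun x => f x * derive1 phi x) =
    - Rintegral mu I (fun x => g x * phi x).

Definition edge_shape I := (exists2 L : R, 0 < L & I = `[0, L]%classic) \/ I = `[0, +oo[%classic.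

Lemma edge_measurable I : edge_shape I -> measurable I.
Proof. by case=> [[L _ ->]|->]. Qed.

Lemma edge_ge0 I x : edge_shape I -> I x -> 0 <= x.
Proof. by case=> [[L _ ->]|->] /=; rewrite in_itv /= => /andP[]. Qed.

Lemma edge_interior_gt0 I x : edge_shape I -> I° x -> 0 < x.
Proof.
by case=> [[L _ ->]|->]; rewrite ?interior_itv_bnd ?interior_itv_bndy /= in_itv /= => /andP[].
Qed.

Lemma edge_interior_le I x y : edge_shape I -> I° x -> 0 < y -> y <= x -> I° y.
Proof.
case=> [[L _ ->]|->]; rewrite ?interior_itv_bnd ?interior_itv_bndy /= !in_itv /=.
  by move=> /andP[x0 xL] y0 yx; rewrite y0 (le_lt_trans yx).
by move=> _ ->.
Qed.

Lemma edge_subset I x : edge_shape I -> I° x -> `[0, x] `<=` I.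
Proof.
case=> [[L _ ->]|->]; rewrite ?interior_itv_bnd ?interior_itv_bndy /= !in_itv /=.
  by move=> /andP[x0 xL] y /=; rewrite !in_itv /= => /andP[-> yx]; rewrite (le_trans yx) ?ltW.
by move=> _ y /=; rewrite !in_itv /= => /andP[->].
Qed.

(** The boundary of an edge has at most two points. *)
Lemma edge_boundary I : edge_shape I -> {ae mu, forall x, I x -> I° x}.
Proof.
case=> [[L L0 ->]|->]; rewrite ?interior_itv_bnd ?interior_itv_bndy.
  exists ([set 0] `|` [set L]); split.
  - exact: measurableU.
  - have H r : mu [set r] = 0%E by exact: lebesgue_measure_set1.
    by rewrite measureU0 //; exact: H.
  - move=> x /= /not_implyP []; rewrite !in_itv /= => /andP[x0 xL] /negP.
    rewrite negb_and -!leNgt => /orP[h|h]; [left|right]; apply/eqP; rewrite eq_le.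
      by rewrite h x0.
    by rewrite h xL.
exists [set 0]; split => //; first exact: lebesgue_measure_set1.
move=> x /= /not_implyP []; rewrite !in_itv /= !andbT => x0 /negP.
by rewrite -leNgt => h; apply/eqP; rewrite eq_le h x0.
Qed.

(** From |f g| <= f^2 + g^2. *)
Lemma L2M_integrable I f g : measurable I -> L2 I f -> L2 I g ->
  mu.-integrable I (EFin \o (fun x => f x * g x)).
Proof.
move=> mI [mf f2] [mg g2].
apply: (@le_integrable _ _ _ mu _ mI _ (EFin \o (fun x => f x ^+ 2 + g x ^+ 2))).
- by apply/measurable_EFinP; exact: measurable_funM.
- move=> x _; rewrite /= lee_fin normrM [leRHS]ger0_norm ?addr_ge0 ?sqr_ge0//.
  have -> : f x ^+ 2 = `|f x| ^+ 2 by rewrite real_normK ?num_real.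
  have -> : g x ^+ 2 = `|g x| ^+ 2 by rewrite real_normK ?num_real.
  by have := normr_ge0 (f x); have := normr_ge0 (g x); nra.
- by apply: (mu_eq mI _ (muD mI f2 g2)) => x _; rewrite /= EFinD.
Qed.

Lemma L2Z I f c : measurable I -> L2 I f -> L2 I (fun x => c * f x).
Proof.
move=> mI [mf f2]; split; first by apply: measurable_funM => //; exact: measurable_cst.
apply: (mu_eq mI _ (muZ mI (c ^+ 2) f2)).
by move=> x _; rewrite /= -EFinM exprMn.
Qed.

Lemma L2D I f g : measurable I -> L2 I f -> L2 I g -> L2 I (fun x => f x + g x).
Proof.
move=> mI lf lg; split; first by apply: measurable_funD; [exact: lf.1|exact: lg.1].
have i := muD mI (muD mI lf.2 lg.2)
  (muZ mI 2 (L2M_integrable mI lf lg)).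
apply: (mu_eq mI _ i).
by move=> x _; rewrite /= -EFinM -!EFinD; congr (_%:E); ring.
Qed.

Lemma L2_lin I f g c d : measurable I -> L2 I f -> L2 I g ->
  L2 I (fun x => c * f x + d * g x).
Proof. by move=> mI lf lg; apply: L2D => //; exact: L2Z. Qed.

Lemma L2S I J f : measurable I -> measurable J -> J `<=` I -> L2 I f -> L2 J f.
Proof.
move=> mI mJ JI [mf f2]; split; first exact: measurable_funS mf.
exact: (muS _ _ _ f2).
Qed.

Lemma vanish_integrable I phi M : measurable I -> continuous phi ->
  (forall x, M < `|x| -> phi x = 0) -> mu.-integrable I (EFin \o phi).
Proof.
move=> mI cphi v.
apply: (@integrableS _ _ _ mu setT) => //.
have := (integrable_mkcond (mu := mu) (EFin \o phi) (measurable_itv `[- M, M])).1.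
rewrite (_ : (EFin \o phi) \_ _ = EFin \o phi); last first.
  apply/funext => x; rewrite patchE; case: ifPn => // /negP xM.
  rewrite /= v // ltNge; apply/negP => xM'; apply: xM.
  by rewrite inE /= in_itv /= -ler_norml.
apply; apply: continuous_compact_integrable; first exact: segment_compact.
exact/continuous_subspaceT.
Qed.

Lemma vanish_L2 I phi M : measurable I -> continuous phi ->
  (forall x, M < `|x| -> phi x = 0) -> L2 I phi.
Proof.
move=> mI cphi v; split; first by apply: measurable_funTS; exact: continuous_measurable_fun.
apply: (@vanish_integrable _ _ M) => //.
  by move=> x; apply: cvgM; exact: cphi.
by move=> x /v ->; rewrite expr0n.
Qed.

Lemma vanish_derive1 phi M : (forall x, M < `|x| -> phi x = 0) ->
  forall x, M < `|x| -> derive1 phi x = 0.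
Proof.
move=> v x xM; rewrite derive1E.
rewrite (near_eq_derive (g := cst 0)) ?derive_cst //.
have : nbhs x [set y | M < `|y|].
  apply: open_nbhs_nbhs; split => //.
  rewrite (_ : [set _ | _] = (fun y : R => `|y|) @^-1` [set y : R | M < y]) //.
  by apply: open_comp; [move=> y _; exact: norm_continuous|exact: open_gt].
by apply: filterS => y /v.
Qed.

Lemma test_C1 I phi : C1_compact_support I phi -> C1 phi.
Proof. by move=> [d c _]; exact: (conj d c). Qed.

Lemma test_vanish I phi : C1_compact_support I phi ->
  exists2 M, 0 <= M & forall x, M < `|x| -> phi x = 0.
Proof.
case=> _ _ [K [cK KI v]].
have [M [Mr MK]] := compact_bounded cK.
exists (Num.max 0 (M + 1)); first by rewrite le_max lexx.
move=> x xM; apply: v => Kx.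
have /(MK (M + 1)) /= H : M < M + 1 by rewrite ltrDl.
have := H _ Kx; rewrite leNgt => /negP; apply.
by move: xM; rewrite gt_max => /andP[].
Qed.

Lemma test_L2 I phi : measurable I -> C1_compact_support I phi ->
  L2 I phi /\ L2 I (derive1 phi).
Proof.
move=> mI t; have [M M0 v] := test_vanish t; have c := test_C1 t.
split; apply: (@vanish_L2 _ _ M) => //.
- exact: C1_continuous.
- exact: c.2.
- exact: vanish_derive1.
Qed.

Lemma test_notin I phi x : C1_compact_support I phi -> ~ I° x -> phi x = 0.
Proof. by case=> _ _ [K [_ KI v]] Ix; apply: v => /KI. Qed.

Lemma testM I phi f : C1 f -> C1_compact_support I phi ->
  C1_compact_support I (fun x => f x * phi x).
Proof.
move=> cf t; have [cp _] := C1M cf (test_C1 t); case: cp => d c.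
move: t => [_ _ [K [cK KI v]]]; split; [exact: d|exact: c|].
exists K; split; [exact: cK|exact: KI|].
by move=> x Kx; rewrite (v x Kx) mulr0.
Qed.

(** The boundary term at 0 survives: phi need not vanish there. *)
Lemma vanish_FTC phi M : C1 phi -> (forall x, M < `|x| -> phi x = 0) ->
  Rintegral mu `[0, +oo[ (derive1 phi) = - phi 0.
Proof.
move=> c v; pose N := Num.max 1 (M + 1).
have N0 : 0 < N by rewrite lt_max ltr01.
have MN x : N <= x -> M < `|x|.
  move=> Nx; rewrite ger0_norm ?(le_trans (ltW N0))//.
  by apply: lt_le_trans Nx; rewrite lt_max ltrDl ltr01 orbT.
rewrite [LHS](_ : _ = Rintegral mu `[0, N] (derive1 phi)).
  by rewrite (C1_FTC c (ltW N0)) (v N) ?sub0r//; exact: MN.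
rewrite -(setIidr (_ : `[0, N] `<=` `[0, +oo[)); last first.
  by move=> x /=; rewrite !in_itv /= andbT => /andP[].
rewrite Rintegral_mkcondr; apply: eq_Rintegral => x.
rewrite inE /= in_itv /= andbT => x0.
rewrite patchE; case: ifPn => // /negP xN.
apply: (vanish_derive1 v); apply: MN; rewrite leNgt; apply/negP => xN'.
by apply: xN; rewrite inE /= in_itv /= x0 ltW.
Qed.

Lemma test_FTC I phi : edge_shape I -> C1_compact_support I phi ->
  Rintegral mu I (derive1 phi) = 0.
Proof.
move=> sI t; case: (sI) => [[L L0 IE]|IE].
  rewrite IE (C1_FTC (test_C1 t) (ltW L0)).
  rewrite !(test_notin t) ?subrr// IE interior_itv_bnd /= in_itv /= ltxx //.
  by rewrite andbF.
have [M _ v] := test_vanish t.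
rewrite IE (vanish_FTC (test_C1 t) v) (test_notin t) ?oppr0//.
by rewrite IE interior_itv_bndy /= in_itv /= ltxx.
Qed.

(** Integration by parts reduces to the vanishing of the integral of the
    derivative of a test function, because a product of a function of class C^1
    with a test function is a test function. *)
Lemma C1_weak I f : edge_shape I -> C1 f -> weak_real I f (derive1 f).
Proof.
move=> sI cf phi t; have mI := edge_measurable sI.
have [M _ v] := test_vanish t; have cp := test_C1 t.
have := test_FTC sI (testM cf t); rewrite (C1M cf cp).2 RintegralD//.
- by move=> /eqP; rewrite addr_eq0 => /eqP.
- apply: (@vanish_integrable _ _ M) => //.
    by move=> x; apply: cvgM; [exact: C1_continuous|exact: cp.2].
  by move=> x xM; rewrite (vanish_derive1 v) ?mulr0.
- apply: (@vanish_integrable _ _ M) => //.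
    by move=> x; apply: cvgM; [exact: cf.2|exact: C1_continuous].
  by move=> x xM; rewrite v ?mulr0.
Qed.

Lemma weak_lin I f1 g1 f2 g2 c d : measurable I ->
  L2 I f1 -> L2 I g1 -> L2 I f2 -> L2 I g2 ->
  weak_real I f1 g1 -> weak_real I f2 g2 ->
  weak_real I (fun x => c * f1 x + d * f2 x) (fun x => c * g1 x + d * g2 x).
Proof.
move=> mI lf1 lg1 lf2 lg2 w1 w2 phi t.
have [lp lp'] := test_L2 mI t.
have E f g h : L2 I f -> L2 I g -> L2 I h ->
   Rintegral mu I (fun x => (c * f x + d * g x) * h x) =
   c * Rintegral mu I (fun x => f x * h x) + d * Rintegral mu I (fun x => g x * h x).
  move=> lf lg lh.
  have i1 := L2M_integrable mI lf lh; have i2 := L2M_integrable mI lg lh.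
  rewrite -!RintegralZl// -RintegralD//.
  - by apply: eq_Rintegral => x _; ring.
  - exact: (muZ mI c i1).
  - exact: (muZ mI d i2).
by rewrite !E// w1// w2//; ring.
Qed.

End Weak.

(** * Almost everywhere uniqueness of weak derivatives *)

Section Fundamental.
Variable R : realType.
Implicit Types (f g h phi : R -> R) (x y a b M : R) (I J : set R).
Local Notation mu := (@lebesgue_measure R).

Lemma Rintegral_dominated_cvg I (f_ : nat -> R -> R) f g : measurable I ->
  (forall n, measurable_fun I (f_ n)) -> measurable_fun I f ->
  (forall x, I x -> f_ ^~ x @ \oo --> f x) ->
  mu.-integrable I (EFin \o g) -> (forall n x, I x -> `|f_ n x| <= g x) ->
  (fun n => Rintegral mu I (f_ n)) @ \oo --> Rintegral mu I f.
Proof.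
move=> mI mf_ mf cv ig dom.
have [||||i_ _ c] := @dominated_convergence _ _ _ mu I mI
  (fun n => EFin \o f_ n) (EFin \o f) (EFin \o g) _ _ _ ig.
- by move=> n; apply/(@measurable_EFinP _ (measurableTypeR R)); exact: mf_.
- by apply/(@measurable_EFinP _ (measurableTypeR R)); exact: mf.
- by apply: aeW => x Ix; apply: cvg_EFin; [exact: nearW|exact: cv].
- by apply: aeW => x n Ix; rewrite /= lee_fin; exact: dom.
rewrite /Rintegral; apply: fine_cvg; rewrite fineK //.
exact: (@integrable_fin_num _ _ _ mu).
Qed.

Lemma Rintegral_subset I J f : measurable I -> J `<=` I ->
  (forall x, I x -> ~ J x -> f x = 0) -> Rintegral mu I f = Rintegral mu J f.
Proof.
move=> mI JI f0; rewrite -[in RHS](setIidr JI) Rintegral_mkcondr.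
apply: eq_Rintegral => x; rewrite inE => Ix; rewrite patchE.
by case: ifPn => // /negP xJ; apply: f0 => // Jx; apply: xJ; rewrite inE.
Qed.

(** A test function on ]0, x[ for n > 0, tending to the indicator of ]0, x[. *)
Definition bump x (n : nat) y : R :=
  smoothstep (n%:R * y + -1) * smoothstep (- n%:R * y + (n%:R * x - 1)).

Lemma bump_test I x n : edge_shape I -> I° x -> C1_compact_support I (bump x n.+1).
Proof.
move=> sI Ix.
have [c _] := C1M (C1_smoothstep n.+1%:R (-1 : R)).1
  (C1_smoothstep (- n.+1%:R) (n.+1%:R * x - 1)).1.
split; [exact: c.1|exact: c.2|].
have n0 : 0 < n.+1%:R :> R by rewrite ltr0n.
exists `[n.+1%:R^-1, x - n.+1%:R^-1]%classic; split.
- exact: segment_compact.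
- move=> y /=; rewrite in_itv /= => /andP[y1 y2].
  apply: (edge_interior_le sI Ix).
    by apply: lt_le_trans y1; rewrite invr_gt0.
  by apply: le_trans y2 _; rewrite gerBl invr_ge0 ltW.
move=> y /= yn; rewrite /bump.
have [ny|ny] := leP (n.+1%:R * y + -1) 0; first by rewrite smoothstep_le0 // mul0r.
have [ny'|ny'] := leP (- n.+1%:R * y + (n.+1%:R * x - 1)) 0.
  by rewrite [X in _ * X]smoothstep_le0 // mulr0.
exfalso; apply: yn; rewrite in_itv /=; apply/andP; split.
  by rewrite -[_^-1]mulr1 ler_pdivrMl//; lra.
by rewrite lerBrDr -lerBrDl -[_^-1]mulr1 ler_pdivrMl//; lra.
Qed.

Lemma bump_out x n y : ~ (0 < y < x) -> bump x n y = 0.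
Proof.
move=> yx; rewrite /bump.
have [ny|ny] := leP (n%:R * y + -1) 0; first by rewrite smoothstep_le0 // mul0r.
have [ny'|ny'] := leP (- n%:R * y + (n%:R * x - 1)) 0.
  by rewrite [X in _ * X]smoothstep_le0 // mulr0.
have n0 : 0 <= n%:R :> R by rewrite ler0n.
exfalso; apply: yx; apply/andP; split; nra.
Qed.

Lemma bump_bound x n y : `|bump x n y| <= 1.
Proof.
rewrite /bump normrM.
have /andP[a b] := smoothstep_bound (n%:R * y + -1).
have /andP[c d] := smoothstep_bound (- n%:R * y + (n%:R * x - 1)).
by rewrite !ger0_norm// mulr_ile1.
Qed.

Lemma smoothstep_cvg y c : 0 < y ->
  (fun n => smoothstep (n.+1%:R * y + c)) @ \oo --> (1 : R).
Proof.
move=> y0; apply: cvg_near_cst; near=> n.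
apply: smoothstep_ge1.
have : (1 - c) / y <= n%:R by near: n; exact: nbhs_infty_ger.
by rewrite ler_pdivrMr // => H; rewrite -natr1 mulrDl mul1r; lra.
Unshelve. all: by end_near.
Qed.

Lemma bump_cvg x y : 0 < y < x -> (fun n => bump x n.+1 y) @ \oo --> (1 : R).
Proof.
move=> /andP[y0 yx]; rewrite -[X in _ --> X]mulr1.
rewrite (_ : (fun n => _) = (fun n => smoothstep (n.+1%:R * y + -1) *
  smoothstep (n.+1%:R * (x - y) + -1))); last first.
  by apply/funext => n; rewrite /bump; congr (_ * smoothstep _); ring.
by apply: cvgM; apply: smoothstep_cvg => //; rewrite subr_gt0.
Qed.

Lemma L2_integrable_itv I f x : edge_shape I -> L2 I f -> I° x ->
  mu.-integrable `[0, x] (EFin \o f).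
Proof.
move=> sI lf Ix.
have l1 : L2 `[0, x] f.
  exact: (L2S (edge_measurable sI) (measurable_itv _) (edge_subset sI Ix) lf).
have l2 : L2 `[0, x] (cst 1 : R -> R).
  split; first exact: measurable_cst.
  apply: continuous_compact_integrable; first exact: segment_compact.
  apply: continuous_subspaceT => y; rewrite /continuous_at /=; exact: cvg_cst.
apply: (mu_eq (measurable_itv _) _ (L2M_integrable _ l1 l2)) => // y _.
by rewrite /= mulr1.
Qed.

(** The bumps turn orthogonality to test functions into a statement on the
    primitive of h, by dominated convergence. *)
Lemma primitive_eq0 I h x : edge_shape I -> L2 I h ->
  (forall phi, C1_compact_support I phi -> Rintegral mu I (fun y => h y * phi y) = 0) ->
  I° x -> Rintegral mu `[0, x] h = 0.
Proof.
move=> sI lh H Ix.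
have x0 := edge_interior_gt0 sI Ix.
have mI := edge_measurable sI.
have ih := L2_integrable_itv sI lh Ix.
have sub : `]0, x[ `<=` I.
  by move=> y /=; rewrite in_itv /= => /andP[y0 yx]; apply: (edge_subset sI Ix); rewrite /= in_itv /= !ltW.
have mh : measurable_fun `]0, x[  h by exact: (measurable_funS mI sub lh.1).
have iho : mu.-integrable `]0, x[ (EFin \o h).
apply: (muS _ _ _ ih) => // y /=; rewrite !in_itv /= => /andP[/ltW -> /ltW ->] //.
have c : (fun n => Rintegral mu `]0, x[ (fun y => h y * bump x n.+1 y)) @ \oo -->
    Rintegral mu `]0, x[ h.
  apply: (@Rintegral_dominated_cvg _ _ _ (fun y => `|h y|)) => //.
  - move=> n; apply: measurable_funM => //.
    apply: measurable_funTS; apply: continuous_measurable_fun.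
    by apply: C1_continuous; apply: (test_C1 (I := I)); exact: bump_test.
  - move=> y /=; rewrite in_itv /= => xy; rewrite -[X in _ --> X]mulr1.
    by apply: cvgM; [exact: cvg_cst|exact: bump_cvg].
  - by have := integrable_norm iho.
  - by move=> n y _; rewrite normrM ler_piMr// bump_bound.
have E : Rintegral mu `]0, x[ h = 0.
  apply: (cvg_unique (@Rhausdorff _) c).
  apply: cvg_near_cst; near=> n.
  rewrite -(Rintegral_subset mI sub); first by rewrite (H _ (bump_test n sI Ix)).
  by move=> y Iy /=; rewrite in_itv /= => xy; rewrite bump_out// mulr0.
transitivity (Rintegral mu `]0, x[ h); last exact: E.
rewrite (Rintegral_itv_obnd_cbnd iho) Rintegral_itv_bndo_bndc //.
by apply: (muS _ _ _ ih) => // y /=; rewrite !in_itv /= => /andP[-> /ltW ->].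
Unshelve. all: by end_near.
Qed.

End Fundamental.

Section Fundamental2.
Variable R : realType.
Implicit Types (f g h phi : R -> R) (x y a b M : R) (I J : set R).
Local Notation mu := (@lebesgue_measure R).

Lemma aeS (P Q : R -> Prop) : (forall x, P x -> Q x) ->
  {ae mu, forall x, P x} -> {ae mu, forall x, Q x}.
Proof. by move=> PQ; apply: filterS PQ; exact: (ae_filter_ringOfSetsType mu). Qed.

Lemma aeS2 (P Q S : R -> Prop) : (forall x, P x -> Q x -> S x) ->
  {ae mu, forall x, P x} -> {ae mu, forall x, Q x} -> {ae mu, forall x, S x}.
Proof. by move=> PQ; apply: filterS2 PQ; exact: (ae_filter_ringOfSetsType mu). Qed.

(** Square integrability only gives integrability on bounded intervals, so an
    edge has to be exhausted by countably many of them. *)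
Lemma edge_exhaust I : edge_shape I -> exists b : nat -> R,
  (forall n, I° (b n)) /\ forall x, I° x -> exists n, x < b n.
Proof.
case=> [[L L0 ->]|->]; rewrite ?interior_itv_bnd ?interior_itv_bndy /=.
  exists (fun n => L - L / n.+2%:R); split=> [n|x].
    rewrite in_itv /= subr_gt0 ltrBlDr ltrDl divr_gt0// andbT.
    by rewrite ltr_pdivrMr// ltr_pMr// ltr1n.
  rewrite /= in_itv /= => /andP[x0 xL].
  near \oo => n; exists n.
  have : L / (L - x) <= n%:R by near: n; exact: nbhs_infty_ger.
  rewrite ler_pdivrMr ?subr_gt0// => H.
  rewrite ltrBrDr -ltrBrDl ltr_pdivrMr // mulrC.
  by apply: le_lt_trans H _; rewrite ltr_pM2r ?subr_gt0// ltr_nat.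
exists (fun n => n.+1%:R); split=> [n|x]; first by rewrite in_itv /= andbT.
rewrite /= => _; near \oo => n; exists n.
apply: (@le_lt_trans _ _ n%:R); last by rewrite ltr_nat.
by near: n; exact: nbhs_infty_ger.
Unshelve. all: by end_near.
Qed.

(** Lebesgue differentiation: almost everywhere h is the derivative of its
    primitive. *)
Lemma primitive_eq0_ae h M : mu.-integrable `[0, M] (EFin \o h) ->
  (forall x, 0 < x < M -> Rintegral mu `[0, x] h = 0) ->
  {ae mu, forall x, 0 < x < M -> h x = 0}.
Proof.
move=> ih H.
have mM : measurable (`[0, M] : set R) by exact: measurable_itv.
have loc := integrable_locally mM ih.
have iT : mu.-integrable setT (EFin \o (h \_ `[0, M])).
  by have := (integrable_mkcond (mu := mu) _ mM).1 ih; rewrite restrict_EFin.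
have iy y : mu.-integrable [set` Interval (BLeft 0) (BRight y)] (EFin \o (h \_ `[0, M])).
  exact: (@integrableS _ _ _ mu _ _ _ measurableT (measurable_itv _) (@subsetT _ _) iT).
apply: aeS (FTC1 iy loc) => x D x0M.
have /andP[x0 xM] := x0M.
move: D; rewrite /= lte_fin => /(_ x0) [_].
rewrite patchE ifT; last by rewrite inE /= in_itv /= !ltW.
move=> <-; rewrite derive1E (near_eq_derive (g := cst 0)) ?derive_cst //.
have : nbhs x `]0, M[%classic by apply: near_in_itvoo; rewrite in_itv.
apply: filterS => y /=; rewrite in_itv /= => yM.
rewrite -[RHS](H y yM); apply: eq_Rintegral => z; rewrite inE /= in_itv /= => /andP[z0 zy].
rewrite patchE ifT// inE /= in_itv /= z0.
by case/andP: yM => _ /ltW /(le_trans zy).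
Qed.

(** The fundamental lemma of the calculus of variations. *)
Lemma fundamental_lemma I h : edge_shape I -> L2 I h ->
  (forall phi, C1_compact_support I phi -> Rintegral mu I (fun y => h y * phi y) = 0) ->
  {ae mu, forall x, I x -> h x = 0}.
Proof.
move=> sI lh H.
have [b [Ib bI]] := edge_exhaust sI.
have P n : {ae mu, forall x, 0 < x < b n -> h x = 0}.
  apply: primitive_eq0_ae; first exact: (L2_integrable_itv sI lh).
  move=> x /andP[x0 xb]; apply: (primitive_eq0 sI lh H).
  exact: (edge_interior_le sI (Ib n) x0 (ltW xb)).
apply: aeS2 (edge_boundary sI) (ae_foralln P) => x Ix E /Ix Iox.
have [n xn] := bI _ Iox; apply: (E n).
by rewrite xn (edge_interior_gt0 sI Iox).
Qed.

Lemma weak_unique I f g1 g2 : edge_shape I -> L2 I g1 -> L2 I g2 ->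
  weak_real I f g1 -> weak_real I f g2 -> {ae mu, forall x, I x -> g1 x = g2 x}.
Proof.
move=> sI l1 l2 w1 w2; have mI := edge_measurable sI.
have := @fundamental_lemma I (fun x => 1 * g1 x + -1 * g2 x) sI.
move=> /(_ (L2_lin _ _ mI l1 l2)) H.
apply: aeS (H _) => [x E Ix|phi t].
  by have := E Ix; rewrite mul1r mulN1r => /eqP; rewrite subr_eq0 => /eqP.
have [lp _] := test_L2 mI t.
have i1 := L2M_integrable mI l1 lp; have i2 := L2M_integrable mI l2 lp.
transitivity (Rintegral mu I (fun x => g1 x * phi x - g2 x * phi x)).
  by apply: eq_Rintegral => x _; ring.
by rewrite RintegralB// -[X in X - _]opprK -w1// -[X in _ - X]opprK -w2// subrr.
Qed.

End Fundamental2.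

(** * Translation and extension by zero on the half line *)

Section HalfLine.
Variable R : realType.
Implicit Types (f g h phi w v : R -> R) (x y a b M : R) (I J : set R).
Local Notation mu := (@lebesgue_measure R).
Local Notation half := (`[0, +oo[%classic : set R).

Lemma half_shape : edge_shape half.
Proof. by right. Qed.

Lemma lebesgue_measure_shift a (A : set R) : measurable A ->
  pushforward mu (fun y : measurableTypeR R => (y + a : measurableTypeR R)) A = mu A.
Proof.
have mphi : measurable_fun setT (fun y : measurableTypeR R => (y + a : measurableTypeR R)).
  by apply: measurable_funD.
pose m := isMeasurableFun.Build _ _ _ _ _ mphi.
pose phi : {mfun measurableTypeR R >-> measurableTypeR R} := HB.pack (fun y : measurableTypeR R => (y + a : measurableTypeR R)) m.
move=> mA; apply/esym; apply: (lebesgue_measure_unique (mu := (pushforward mu phi))) => //= _ [[c d]] _ <-.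
rewrite /pushforward /=.
rewrite (_ : _ @^-1` _ = `]c - a, d - a]%classic); last first.
  by apply/seteqP; split => x /=; rewrite !in_itv /= ltrBlDr lerBrDr.
rewrite !lebesgue_measure_itv/= !lte_fin ltrD2r.
by case: ifPn => // _; rewrite -!EFinD; congr (_%:E); ring.
Qed.

(** No integrability is needed: positive and negative parts are translated
    separately. *)
Lemma integral_shift a (F : R -> \bar R) : measurable_fun `[a, +oo[ F ->
  (\int[mu]_(x in `[a, +oo[) F x = \int[mu]_(x in half) F (x + a)%R)%E.
Proof.
move=> mF.
have mphi : measurable_fun setT (fun y : measurableTypeR R => (y + a : measurableTypeR R)).
  by apply: measurable_funD.
have E (G : R -> \bar R) : measurable_fun `[a, +oo[ G ->
    (forall x, 0 <= G x)%E ->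
    (\int[mu]_(x in `[a, +oo[) G x = \int[mu]_(x in half) G (x + a)%R)%E.
  move=> mG G0.
  rewrite -[RHS]/(\int[mu]_(x in half) (G \o (fun y => y + a)%R) x)%E.
  rewrite (_ : half = (fun y : measurableTypeR R => (y + a : measurableTypeR R)) @^-1` `[a, +oo[); last first.
    by apply/seteqP; split => x /=; rewrite !in_itv /= !andbT lerDr.
  rewrite -(ge0_integral_pushforward mphi mu) //.
  by apply: eq_measure_integral => //= A mA _; exact/esym/lebesgue_measure_shift.
rewrite integralE [RHS]integralE; congr (_ - _)%E.
  rewrite E //; [by apply: eq_integral => x _; rewrite !funeposE|exact: (measurable_funepos mF)].
rewrite E //; [by apply: eq_integral => x _; rewrite !funenegE|exact: (measurable_funeneg mF)].
Qed.

Lemma Rintegral_shift a f : measurable_fun `[a, +oo[ f ->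
  Rintegral mu `[a, +oo[ f = Rintegral mu half (fun x => f (x + a)).
Proof.
move=> mf; rewrite /Rintegral integral_shift//.
exact/measurable_EFinP.
Qed.

Lemma half_sub a : 0 <= a -> `[a, +oo[ `<=` half.
Proof.
by move=> a0 x /=; rewrite !in_itv /= !andbT; exact: le_trans.
Qed.

Lemma measurable_shift a f : measurable_fun `[a, +oo[ f ->
  measurable_fun half (fun x => f (x + a)).
Proof.
move=> mf; apply: (@measurable_comp _ _ _ _ _ _ `[a, +oo[ f _ (fun x => x + a)) => //.
- by move=> _ [x /= + <-]; rewrite !in_itv /= !andbT lerDr.
- by apply: measurable_funD.
Qed.

Lemma measurable_shiftN a f : measurable_fun half f ->
  measurable_fun `[a, +oo[ (fun x => f (x - a)).
Proof.
move=> mf; apply: (@measurable_comp _ _ _ _ _ _ half f _ (fun x => x - a)) => //.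
- by move=> _ [x /= + <-]; rewrite !in_itv /= !andbT subr_ge0.
- by apply: measurable_funB.
Qed.

(** Extension by zero to [0, a[ of a function moved by a to the right. *)
Definition zext a w : R -> R := (fun x => w (x - a)) \_ `[a, +oo[.

Lemma zext_out a w x : x < a -> zext a w x = 0.
Proof.
by move=> xa; rewrite /zext patchE ifF//; apply/negP; rewrite inE /= in_itv /= andbT leNgt xa.
Qed.

Lemma zext_in a w x : 0 <= x -> zext a w (x + a) = w x.
Proof.
by move=> x0; rewrite /zext patchE ifT ?addrK// inE /= in_itv /= andbT lerDr.
Qed.

Lemma measurable_zext a w : 0 <= a -> measurable_fun half w -> measurable_fun half (zext a w).
Proof.
move=> a0 mw; apply/measurable_restrict => //.
rewrite setIidr; last exact: half_sub.
exact: measurable_shiftN.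
Qed.

Lemma L2_shift a f : 0 <= a -> L2 half f -> L2 half (fun x => f (x + a)).
Proof.
move=> a0 [mf /integrableP[_ f2]].
have mfa : measurable_fun `[a, +oo[ f by exact: (measurable_funS _ (half_sub a0) mf).
have ma := measurable_shift mfa.
split => //; apply/integrableP; split.
  by apply/(@measurable_EFinP _ (measurableTypeR R)); exact: measurable_funM.
rewrite -(@integral_shift a (fun x => `|(f x ^+ 2)%:E|%E)); last first.
  apply: measurableT_comp => //.
  by apply/measurable_EFinP; apply: measurable_funM.
apply: le_lt_trans f2; apply: ge0_subset_integral => //; last exact: half_sub.
by apply: measurableT_comp => //; apply/(@measurable_EFinP _ (measurableTypeR R)); exact: measurable_funM.
Qed.

Lemma L2_zext a w : 0 <= a -> L2 half w -> L2 half (zext a w).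
Proof.
move=> a0 [mw /integrableP[_ w2]].
have mz := measurable_zext a0 mw.
split => //; apply/integrableP; split.
  by apply/(@measurable_EFinP _ (measurableTypeR R)); exact: measurable_funM.
rewrite [ltLHS](_ : _ = \int[mu]_(x in `[a, +oo[) `|(zext a w x ^+ 2)%:E|)%E; last first.
  rewrite -(setIidr (half_sub a0)) integral_mkcondr; apply: eq_integral => x _.
  rewrite patchE; case: ifPn => // /negP xa; rewrite /= zext_out ?expr0n ?normr0//.
  by rewrite ltNge; apply/negP => ax; apply: xa; rewrite inE /= in_itv /= andbT.
rewrite integral_shift; last first.
  apply: (measurable_funS _ (half_sub a0)) => //.
  by apply: measurableT_comp => //; apply/measurable_EFinP; exact: measurable_funM.
apply: le_lt_trans w2; rewrite le_eqVlt; apply/orP; left; apply/eqP.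
apply: eq_integral => x; by rewrite inE /= in_itv /= andbT => x0; rewrite zext_in.
Qed.

Lemma test_derive_notin I phi x : C1_compact_support I phi -> ~ I° x -> derive1 phi x = 0.
Proof.
case=> _ _ [K [cK KI vK]] Ix; rewrite derive1E (near_eq_derive (g := cst 0)) ?derive_cst //.
have : nbhs x (~` K).
  apply: open_nbhs_nbhs; split; last by move=> /KI.
  by apply: closed_openC; apply: compact_closed => //; exact: Rhausdorff.
by apply: filterS => y /vK.
Qed.

Lemma test_shift a phi : 0 <= a -> C1_compact_support half phi ->
  C1_compact_support half (fun x => phi (x - a)).
Proof.
move=> a0 t; have [[d c] _] := C1_shift (- a) (test_C1 t).
move: t => [_ _ [K [cK KI vK]]]; split; [exact: d|exact: c|].
exists ((fun x => x + a) @` K); split.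
- apply: continuous_compact => //; apply: continuous_subspaceT => x.
  by apply: cvgD; [exact: cvg_id|exact: cvg_cst].
- move=> _ [x /KI Kx <-]; move: Kx; rewrite !interior_itv_bndy /= !in_itv /= !andbT.
  by move=> x0; rewrite ltr_wpDr.
- move=> x nx; apply: vK => Kx; apply: nx; exists (x - a) => //; first by rewrite subrK.
Qed.

Lemma weak_shift a f g : 0 <= a -> L2 half f -> L2 half g -> weak_real half f g ->
  weak_real half (fun x => f (x + a)) (fun x => g (x + a)).
Proof.
move=> a0 lf lg wfg phi t.
have t' := test_shift a0 t.
have mh : measurable half by [].
have S h psi : L2 half h -> L2 half (fun x => psi (x - a)) ->
    (forall x, x < 0 -> psi x = 0) ->
    Rintegral mu half (fun x => h (x + a) * psi x) =
    Rintegral mu half (fun x => h x * psi (x - a)).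
  move=> lh lp p0.
  rewrite [RHS](Rintegral_subset _ (half_sub a0)) //; last first.
    move=> x _ xa; rewrite p0 ?mulr0// subr_lt0 ltNge; apply/negP => ax.
    by apply: xa; rewrite /= in_itv /= andbT.
  rewrite Rintegral_shift.
    by apply: eq_Rintegral => x _; rewrite addrK.
  apply: (measurable_funS _ (half_sub a0)) => //.
  by apply: measurable_funM; [exact: lh.1|exact: lp.1].
have neg x : x < 0 -> ~ half° x.
  by move=> x0; rewrite interior_itv_bndy /= in_itv /= andbT => /(lt_trans x0); rewrite ltxx.
have [lp lp'] := test_L2 mh t'.
have [_ D] := C1_shift (- a) (test_C1 t).
rewrite D in lp'.
rewrite !S//.
- by have := wfg _ t'; rewrite D.
- by move=> x /neg; exact: (test_notin t).
- by move=> x /neg; exact: (test_derive_notin t).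
Qed.

Lemma vanish_bounded phi M : continuous phi -> (forall x, M < `|x| -> phi x = 0) ->
  exists C, forall x, `|phi x| <= C.
Proof.
move=> cp v; have [M0|M0] := ltP M 0.
  by exists 0 => x; rewrite v ?normr0// (lt_le_trans M0).
have cn : {within `[- M, M], continuous (fun x => `|phi x|)}.
  by apply: continuous_subspaceT => x; apply: cvg_norm; exact: cp.
have MM : - M <= M by rewrite ge0_cp.
have [c _ cmax] := EVT_max MM cn.
exists `|phi c| => x; have [xM|xM] := leP `|x| M.
  by apply: cmax; rewrite in_itv /= -ler_norml.
by rewrite v ?normr0.
Qed.

End HalfLine.

Section Zext.
Variable R : realType.
Implicit Types (f g h phi w v : R -> R) (x y a b M : R) (I J : set R).
Local Notation mu := (@lebesgue_measure R).
Local Notation half := (`[0, +oo[%classic : set R).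

Lemma cutoff_test phi M n : C1 phi -> (forall x, M < `|x| -> phi x = 0) ->
  C1_compact_support half (fun x => smoothstep (n.+1%:R * x + -1) * phi x).
Proof.
move=> cp v.
have [cs _] := C1_smoothstep (n.+1%:R) (-1 : R).
have [[d c] _] := C1M cs cp.
have n0 : 0 < n.+1%:R :> R by rewrite ltr0n.
split; [exact: d|exact: c|].
exists `[n.+1%:R^-1, M]%classic; split.
- exact: segment_compact.
- move=> y /=; rewrite interior_itv_bndy /= !in_itv /= andbT => /andP[+ _].
  by apply: lt_le_trans; rewrite invr_gt0.
move=> y /= yn.
have [ny|ny] := leP (n.+1%:R * y + -1) 0; first by rewrite smoothstep_le0 // mul0r.
have [My|My] := ltP M `|y|; first by rewrite v // mulr0.
exfalso; apply: yn; rewrite in_itv /=; apply/andP; split.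
  by rewrite -[_^-1]mulr1 ler_pdivrMl//; lra.
exact: le_trans (ler_norm _) My.
Qed.

(** Cutting a function off near 0 does not matter in the limit. *)
Lemma cutoff_cvg h phi : L2 half h -> L2 half phi ->
  (fun n => Rintegral mu half (fun x => h x * (smoothstep (n.+1%:R * x + -1) * phi x)))
    @ \oo --> Rintegral mu half (fun x => h x * phi x).
Proof.
move=> lh lp; have mh : measurable half by [].
have ih := L2M_integrable mh lh lp.
have N (k : R -> R) : measurable_fun half k ->
  Rintegral mu half k = Rintegral mu `]0, +oo[ k.
  move=> mk; rewrite /Rintegral; congr fine.
  rewrite integral_itv_obnd_cbnd //.
  apply: (@measurable_funS _ _ _ _ half) => //.
    by move=> x /=; rewrite !in_itv /= !andbT => /ltW.
  exact/measurable_EFinP.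
have ms n : measurable_fun half (fun x => smoothstep (n.+1%:R * x + -1) : R).
  apply: measurable_funTS; apply: continuous_measurable_fun.
  exact: C1_continuous (C1_smoothstep _ _).1.
have m1 n : measurable_fun half (fun x => h x * (smoothstep (n.+1%:R * x + -1) * phi x)).
  by apply: measurable_funM; [exact: lh.1|apply: measurable_funM; [exact: ms|exact: lp.1]].
have m2 : measurable_fun half (fun x => h x * phi x).
  by apply: measurable_funM; [exact: lh.1|exact: lp.1].
have sub : `]0, +oo[ `<=` half.
  by move=> x /=; rewrite !in_itv /= !andbT => /ltW.
rewrite N//; under eq_fun do rewrite N//.
apply: (@Rintegral_dominated_cvg _ _ _ _ (fun x => `|h x * phi x|)) => //.
- by move=> n; apply: (measurable_funS _ sub).
- exact: (measurable_funS _ sub).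
- move=> x /=; rewrite in_itv /= andbT => x0.
  apply: cvgM; first exact: cvg_cst.
  rewrite -[X in _ --> X]mul1r; apply: cvgM; last exact: cvg_cst.
  exact: smoothstep_cvg.
- have := integrable_norm (@integrableS _ _ _ mu _ _ _ mh (measurable_itv _) sub ih).
  by [].
- move=> n x _; rewrite !normrM mulrCA ler_piMl ?mulr_ge0//.
  by have /andP[a0 a1] := smoothstep_bound (n.+1%:R * x + -1); rewrite ger0_norm.
Qed.

(** The derivative of the cutoff is of size n on an interval of length 2 / n; the
    factor w is small there since it is continuous and vanishes at 0. *)
Lemma cutoff_error w phi M : L2 half w -> {within half, continuous w} -> w 0 = 0 ->
  continuous phi -> (forall x, M < `|x| -> phi x = 0) ->
  (fun n => Rintegral mu half
     (fun x => w x * (smoothstep' (n.+1%:R * x + -1) * n.+1%:R * phi x))) @ \oo --> (0 : R).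
Proof.
move=> lw cw w0 cp v; have [C bC] := vanish_bounded cp v.
have C0 : 0 <= C by apply: le_trans (bC 0).
apply/cvgrPdist_le => e e0.
pose e1 := e / (4 * (C + 1)).
have e10 : 0 < e1 by rewrite divr_gt0// mulr_gt0// ltr_wpDl.
have [d d0 wd] : exists2 d, 0 < d & forall x, 0 <= x -> x < d -> `|w x| <= e1.
  have /continuous_within_itvcyP[_ /cvgrPdist_le /(_ _ e10)] := cw.
  rewrite w0 /at_right near_withinE => /nbhs_ballP[d /= d0 H].
  exists d => // x; rewrite le_eqVlt => /predU1P[<- _|x0 xd].
    by rewrite w0 normr0 ltW.
  have := H x; rewrite /ball /= sub0r normrN gtr0_norm// sub0r normrN => /(_ xd).
  exact.
near=> n.
have n0 : 0 < n.+1%:R :> R by rewrite ltr0n.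
rewrite sub0r normrN.
pose u := 2 / n.+1%:R :> R.
have u0 : 0 < u by rewrite divr_gt0.
have ud : u < d.
  have : 2 / d <= n%:R by near: n; exact: nbhs_infty_ger.
  rewrite ler_pdivrMr// => H; rewrite ltr_pdivrMr// mulrC.
  by apply: le_lt_trans H _; rewrite ltr_pM2r// ltr_nat.
have usub : `[0, u] `<=` half by move=> x /=; rewrite !in_itv /= andbT => /andP[].
have mh : measurable half by [].
pose F x := w x * (smoothstep' (n.+1%:R * x + -1) * n.+1%:R * phi x).
have F0 x : half x -> ~ `[0, u]%classic x -> F x = 0.
  rewrite /= !in_itv /= andbT => x0 xu; rewrite /F smoothstep'_out ?mul0r ?mulr0//.
  right; rewrite lerBrDr; have [//|H] := leP (1 + 1) (n.+1%:R * x).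
  by exfalso; apply: xu; rewrite x0 /= /u ler_pdivlMr// mulrC; apply: ltW.
have mF : measurable_fun half F.
  apply: measurable_funM; first exact: lw.1.
  apply: measurable_funTS; apply: continuous_measurable_fun => x.
  apply: cvgM; last exact: cp.
  by have [[_ c] E] := C1_smoothstep (n.+1%:R : R) (-1); rewrite E in c; exact: c.
have Fb x : `[0, u]%classic x -> `|F x| <= e1 * (2 * n.+1%:R * C).
  rewrite /= in_itv /= => /andP[x0 xu]; rewrite /F normrM; apply: ler_pM => //.
    by apply: wd => //; exact: le_lt_trans ud.
  rewrite !normrM [X in _ * X * _]gtr0_norm//; apply: ler_pM => //.
  by apply: ler_pM => //; exact: smoothstep'_bound.
rewrite (Rintegral_subset mh usub F0).
have iF : mu.-integrable `[0, u] (EFin \o F).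
  apply: measurable_bounded_integrable => //.
  - by rewrite /= lebesgue_measure_itv /= lte_fin u0 ltry.
  - exact: (measurable_funS _ usub).
  - exists (e1 * (2 * n.+1%:R * C)); split; first exact: num_real.
    by move=> x xM y /= yI; apply: le_trans (Fb y yI) _; exact: ltW.
apply: le_trans (le_normr_Rintegral _ iF) _ => //.
apply: (@le_trans _ _ (Rintegral mu `[0, u] (fun=> e1 * (2 * n.+1%:R * C)))).
  apply: le_Rintegral => //.
  - exact: (integrable_norm iF).
  - apply: continuous_compact_integrable; first exact: segment_compact.
    by apply: continuous_subspaceT => x; exact: cvg_cst.
rewrite Rintegral_cst //= lebesgue_measure_itv /= lte_fin u0 /= oppr0 addr0.
rewrite /u /e1.
have -> : e / (4 * (C + 1)) * (2 * n.+1%:R * C) * (2 / n.+1%:R) = e * (C / (C + 1)).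
  by field; rewrite ?gt_eqF//= ltr_wpDl.
rewrite ler_piMr ?(ltW e0)// ler_pdivrMr ?ltr_wpDl// mul1r lerDl //.
Unshelve. all: by end_near.
Qed.

(** When w vanishes at 0, there is no boundary term at 0 even though phi need
    not vanish there: cut phi off near 0 and let the cutoff go to 1. *)
Lemma weak_vanish0 w v phi M : L2 half w -> L2 half v -> weak_real half w v ->
  {within half, continuous w} -> w 0 = 0 ->
  C1 phi -> (forall x, M < `|x| -> phi x = 0) ->
  Rintegral mu half (fun x => w x * derive1 phi x) =
    - Rintegral mu half (fun x => v x * phi x).
Proof.
move=> lw lv wv cw w0 cp vp.
have mh : measurable half by [].
have lp : L2 half phi by apply: vanish_L2 vp => //; exact: C1_continuous.
have lp' : L2 half (derive1 phi).
  by apply: (vanish_L2 (M := M)) => //; [exact: cp.2|exact: vanish_derive1].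
have c1 := cutoff_cvg lw lp'.
have c2 := cutoff_error lw cw w0 (C1_continuous cp) vp.
have c3 := cvgN (cutoff_cvg lv lp).
have := cvgD c1 c2; rewrite addr0.
set A := Rintegral mu half _; set B := Rintegral mu half _; set D := (X in X @ _ --> _).
move=> c; suff c4 : D @ \oo --> - B by exact: (cvg_unique (@Rhausdorff _) (c _) c4).
apply: cvg_trans (c3 _); apply: near_eq_cvg; near=> n; rewrite /D /=.
have t := cutoff_test n cp vp.
rewrite !fctE -(wv _ t).
have [cs Ds] := C1_smoothstep (n.+1%:R) (-1 : R).
rewrite (C1M cs cp).2 Ds -RintegralD //.
- by apply: eq_Rintegral => x _; ring.
- apply: L2M_integrable => //; split.
    apply: measurable_funM; last exact: lp'.1.
    by apply: measurable_funTS; apply: continuous_measurable_fun; exact: C1_continuous cs.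
  apply: (vanish_L2 (M := M) _ _ _).2 => //.
    by move=> x; apply: cvgM; [exact: C1_continuous cs _|exact: cp.2].
  by move=> x xM; rewrite (vanish_derive1 vp) ?mulr0.
- apply: L2M_integrable => //; apply: (vanish_L2 (M := M)) => //.
    move=> x; apply: cvgM; last exact: C1_continuous cp _.
    by have := cs.2; rewrite Ds; exact.
  by move=> x xM; rewrite vp ?mulr0.
Unshelve. all: by end_near.
Qed.

(** After translation, a test function on the half line becomes one which need
    not vanish at 0, whence [weak_vanish0]. *)
Lemma weak_zext a w v : 0 <= a -> L2 half w -> L2 half v -> weak_real half w v ->
  {within half, continuous w} -> w 0 = 0 -> weak_real half (zext a w) (zext a v).
Proof.
move=> a0 lw lv wv cw w0 phi t.
have mh : measurable half by [].
have [lp lp'] := test_L2 mh t.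
have S h psi : L2 half h -> L2 half psi ->
    Rintegral mu half (fun x => zext a h x * psi x) =
    Rintegral mu half (fun x => h x * psi (x + a)).
  move=> lh lpsi.
  rewrite [LHS](Rintegral_subset _ (half_sub a0)) //; last first.
    move=> x _ xa; rewrite zext_out ?mul0r// ltNge; apply/negP => ax.
    by apply: xa; rewrite /= in_itv /= andbT.
  rewrite Rintegral_shift.
    by apply: eq_Rintegral => x; rewrite inE /= in_itv /= andbT => x0; rewrite zext_in.
  apply: (measurable_funS _ (half_sub a0)) => //.
  by apply: measurable_funM; [exact: measurable_zext a0 lh.1|exact: lpsi.1].
rewrite !S//.
have [c D] := C1_shift a (test_C1 t).
have [M M0 v0] := test_vanish t.
have := @weak_vanish0 w v (fun x => phi (x + a)) (M + a) lw lv wv cw w0 c.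
rewrite D; apply => x xM; apply: v0.
have := ler_normB (x + a) a; rewrite addrK (ger0_norm a0) => H.
by move: (lt_le_trans xM H); rewrite ltrD2r.
Qed.

End Zext.

(** * Complex-valued functions of class H^1 *)

Section Pairs.
Variable R : realType.
Implicit Types (f g w v : R -> R[i]) (x y a b M : R) (I J : set R) (c d z : R[i]).
Local Notation mu := (@lebesgue_measure R).
Local Notation half := (`[0, +oo[%classic : set R).
Local Notation Re := (@complex.Re R).
Local Notation Im := (@complex.Im R).

Definition Lint (q : R) I f : \bar R :=
  (\int[mu]_(x in I) (normc (f x) `^ q)%:E)%E.

Lemma normc2 z : normc z `^ 2 = Re z ^+ 2 + Im z ^+ 2.
Proof.
case: z => s t /=; rewrite powR_mulrn ?sqrtr_ge0// sqr_sqrtr//.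
by rewrite addr_ge0 ?sqr_ge0.
Qed.

Lemma normc_ge0 z : 0 <= normc z :> R.
Proof. by case: z => s t; exact: sqrtr_ge0. Qed.

Lemma measurable_normc I f : measurable_fun I (Re \o f) -> measurable_fun I (Im \o f) ->
  measurable_fun I (fun x => normc (f x)).
Proof.
move=> m1 m2.
rewrite (_ : (fun x => _) = (fun x => Num.sqrt (Re (f x) ^+ 2 + Im (f x) ^+ 2))).
  apply: (@measurableT_comp _ _ _ _ _ _ (@Num.sqrt R)) => //.
    by apply: continuous_measurable_fun; exact: sqrt_continuous.
  by apply: measurable_funD; apply: measurable_funX.
by apply/funext => x; case: (f x).
Qed.

Lemma in_L2_split I f : measurable I -> in_L2 I f <-> L2 I (Re \o f) /\ L2 I (Im \o f).
Proof.
move=> mI; split.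
  move=> [m1 m2 fin].
  have B (u : R -> R) : measurable_fun I u -> (forall x, u x ^+ 2 <= normc (f x) `^ 2) ->
      L2 I u.
    move=> mu_ le; split => //; apply/integrableP; split.
      by apply/(@measurable_EFinP _ (measurableTypeR R)); exact: measurable_funX.
    apply: le_lt_trans fin; apply: ge0_le_integral => //.
    - by apply: measurableT_comp => //; apply/(@measurable_EFinP _ (measurableTypeR R)); exact: measurable_funX.
    - apply/(@measurable_EFinP _ (measurableTypeR R)).
      under eq_fun do rewrite normc2.
      by apply: measurable_funD; apply: measurable_funX.
    - by move=> x _; rewrite /= lee_fin ger0_norm ?sqr_ge0.
  by split; apply: B => // x; rewrite normc2 /= ?lerDl ?lerDr sqr_ge0.
move=> [[m1 i1] [m2 i2]]; split => //.
have := @integrable_lty _ _ _ mu _ mI _ (@integrableD _ _ _ mu _ mI _ _ i1 i2).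
by congr (_ < _)%E; apply: eq_integral => x _; rewrite normc2.
Qed.

Definition H1_real I (u v : R -> R) :=
  [/\ {within I, continuous u}, L2 I u, L2 I v & weak_real I u v].

(** g is carried along as a weak derivative of f, so that modifications of f are
    described together with their derivatives. *)
Definition H1pair I f g :=
  H1_real I (Re \o f) (Re \o g) /\ H1_real I (Im \o f) (Im \o g).

Lemma in_H1P I f : measurable I -> in_H1 I f <-> exists g, H1pair I f g.
Proof.
move=> mI; split.
  move=> [c1 c2 l [g [lg wg]]]; exists g.
  have [a1 a2] := (in_L2_split _ mI).1 l; have [b1 b2] := (in_L2_split _ mI).1 lg.
  by split; split => // phi t; have [] := wg _ t.
move=> [g [[c1 a1 b1 w1] [c2 a2 b2 w2]]]; split => //.
  exact/(in_L2_split _ mI).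
exists g; split; first exact/(in_L2_split _ mI).
by move=> phi t; split; [exact: w1|exact: w2].
Qed.

Lemma weak_derivP I f : measurable I -> in_H1 I f -> H1pair I f (weak_deriv I f).
Proof.
move=> mI [c1 c2 l ex]; have [lg wg] := xgetPex (fun=> 0) ex.
have [a1 a2] := (in_L2_split _ mI).1 l; have [b1 b2] := (in_L2_split _ mI).1 lg.
by split; split => // phi t; have [] := wg _ t.
Qed.

Lemma H1pair_measurable I f g : H1pair I f g ->
  measurable_fun I (fun x => normc (f x)) /\ measurable_fun I (fun x => normc (g x)).
Proof.
move=> [[_ [a1 _] [b1 _] _] [_ [a2 _] [b2 _] _]].
by split; exact: measurable_normc.
Qed.

Lemma measurable_normc_powR I f q : measurable_fun I (fun x => normc (f x)) ->
  measurable_fun I (fun x => (normc (f x) `^ q)%:E).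
Proof.
move=> m; apply/measurable_EFinP.
by apply: (@measurableT_comp _ _ _ _ _ _ (@powR R ^~ q)) => //; exact: measurable_powR.
Qed.

Lemma Lint_ge0 q I f : (0 <= Lint q I f)%E.
Proof. by apply: integral_ge0 => x _; rewrite lee_fin powR_ge0. Qed.

Lemma eq_Lint q I f g : (forall x, I x -> f x = g x) -> Lint q I f = Lint q I g.
Proof. by move=> E; apply: eq_integral => x; rewrite inE => /E ->. Qed.

Lemma H1pair_fin I f g : measurable I -> H1pair I f g ->
  (Lint 2 I f < +oo)%E /\ (Lint 2 I g < +oo)%E.
Proof.
move=> mI [[_ a1 b1 _] [_ a2 b2 _]].
by split; [have [] := (in_L2_split f mI).2 (conj a1 a2)|
           have [] := (in_L2_split g mI).2 (conj b1 b2)].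
Qed.

(** The chosen weak derivative and g agree almost everywhere. *)
Lemma weak_deriv_Lint I f g : edge_shape I -> H1pair I f g ->
  Lint 2 I (weak_deriv I f) = Lint 2 I g.
Proof.
move=> sI h; have mI := edge_measurable sI.
have h' := weak_derivP mI ((in_H1P f mI).2 (ex_intro _ g h)).
have [_ m1] := H1pair_measurable h; have [_ m2] := H1pair_measurable h'.
case: h h' => [[_ _ b1 w1] [_ _ b2 w2]] [[_ _ b1' w1'] [_ _ b2' w2']].
apply: (@ae_eq_integral _ _ _ mu) => //; try exact: measurable_normc_powR.
apply: aeS2 (weak_unique sI b1 b1' w1 w1') (weak_unique sI b2 b2' w2 w2') => x e1 e2 Ix.
by rewrite !normc2; have /= -> := e1 Ix; have /= -> := e2 Ix.
Qed.

Lemma H1_real_lin I (u1 v1 u2 v2 : R -> R) (r s : R) : measurable I ->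
  H1_real I u1 v1 -> H1_real I u2 v2 ->
  H1_real I (fun x => r * u1 x + s * u2 x) (fun x => r * v1 x + s * v2 x).
Proof.
move=> mI [c1 a1 b1 w1] [c2 a2 b2 w2]; split.
- by move=> x; apply: cvgD; apply: cvgM; [exact: cvg_cst|exact: c1|exact: cvg_cst|exact: c2].
- exact: L2_lin.
- exact: L2_lin.
- exact: weak_lin.
Qed.

Lemma ReM c z : Re (c * z) = Re c * Re z - Im c * Im z.
Proof. by case: c => ? ?; case: z. Qed.

Lemma ImM c z : Im (c * z) = Re c * Im z + Im c * Re z.
Proof. by case: c => ? ?; case: z. Qed.

Lemma ReD c z : Re (c + z) = Re c + Re z.
Proof. by case: c => ? ?; case: z. Qed.

Lemma ImD c z : Im (c + z) = Im c + Im z.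
Proof. by case: c => ? ?; case: z. Qed.

Lemma H1pair_lin I f1 g1 f2 g2 c d : measurable I ->
  H1pair I f1 g1 -> H1pair I f2 g2 ->
  H1pair I (fun x => c * f1 x + d * f2 x) (fun x => c * g1 x + d * g2 x).
Proof.
move=> mI [r1 i1] [r2 i2]; split.
  have := H1_real_lin 1 1 mI (H1_real_lin (Re c) (- Im c) mI r1 i1)
                             (H1_real_lin (Re d) (- Im d) mI r2 i2).
  by congr H1_real; apply/funext => x /=; rewrite ReD !ReM; ring.
have := H1_real_lin 1 1 mI (H1_real_lin (Re c) (Im c) mI i1 r1)
                           (H1_real_lin (Re d) (Im d) mI i2 r2).
by congr H1_real; apply/funext => x /=; rewrite ImD !ImM; ring.
Qed.

Lemma H1pairZ I f g c : measurable I -> H1pair I f g ->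
  H1pair I (fun x => c * f x) (fun x => c * g x).
Proof.
move=> mI h; have := H1pair_lin c 0 mI h h.
by congr H1pair; apply/funext => x; rewrite mul0r addr0.
Qed.

Lemma H1pairD I f1 g1 f2 g2 : measurable I ->
  H1pair I f1 g1 -> H1pair I f2 g2 ->
  H1pair I (fun x => f1 x + f2 x) (fun x => g1 x + g2 x).
Proof.
move=> mI h1 h2; have := H1pair_lin 1 1 mI h1 h2.
by congr H1pair; apply/funext => x; rewrite !mul1r.
Qed.

Lemma LintZ q I f c : measurable I -> measurable_fun I (fun x => normc (f x)) ->
  0 <= q -> Lint q I (fun x => c * f x) = ((normc c `^ q)%:E * Lint q I f)%E.
Proof.
move=> mI mf q0; rewrite /Lint.
rewrite -(@ge0_integralZl_EFin _ _ _ mu _ mI) ?powR_ge0//.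
- by apply: eq_integral => x _; rewrite normcM powRM ?normc_ge0// EFinM.
- by move=> x _; rewrite lee_fin powR_ge0.
- exact: measurable_normc_powR.
Qed.

(** The defect D of the midpoint inequality is isolated so that its integral can
    be shown to vanish. *)
Lemma Lint_midpoint_defect q I f f1 f2 : measurable I ->
  measurable_fun I (fun x => normc (f x)) ->
  measurable_fun I (fun x => normc (f1 x)) -> measurable_fun I (fun x => normc (f2 x)) ->
  let D x := normc (f1 x) `^ q + normc (f2 x) `^ q - 2 * normc (f x) `^ q in
  (forall x, 0 <= D x) ->
  measurable_fun I (fun x => (D x)%:E) /\
  (2%:E * Lint q I f + \int[mu]_(x in I) (D x)%:E = Lint q I f1 + Lint q I f2)%E.
Proof.
move=> mI mf mf1 mf2 D D0.
have mp (u : R -> R[i]) : measurable_fun I (fun x => normc (u x)) ->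
    measurable_fun I (fun x => normc (u x) `^ q).
  by move=> m; apply/measurable_EFinP; exact: measurable_normc_powR.
have mD : measurable_fun I (fun x => (D x)%:E).
  apply/measurable_EFinP; apply: measurable_funB; first by apply: measurable_funD; exact: mp.
  by apply: measurable_funM; [exact: measurable_cst|exact: mp].
split => //; rewrite /Lint -(@ge0_integralZl_EFin _ _ _ mu _ mI) //; last 2 first.
- by move=> x _; rewrite lee_fin powR_ge0.
- exact: measurable_normc_powR.
rewrite -(@ge0_integralD _ _ _ mu _ mI) //; last 3 first.
- by move=> x _; rewrite -EFinM lee_fin mulr_ge0// powR_ge0.
- by apply: measurable_funeM; exact: measurable_normc_powR.
- by move=> x _; rewrite lee_fin.
rewrite -(@ge0_integralD _ _ _ mu _ mI) //; last 4 first.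
- by move=> x _; rewrite lee_fin powR_ge0.
- exact: measurable_normc_powR.
- by move=> x _; rewrite lee_fin powR_ge0.
- exact: measurable_normc_powR.
apply: eq_integral => x _; rewrite -EFinM -!EFinD; congr (_%:E); rewrite /D; ring.
Qed.

(** Continuity within the half line becomes plain continuity, which composes
    with translations. *)
Lemma half_continuousP (u : R -> R) :
  {within half, continuous u} <-> continuous (fun x => u (Num.max 0 x)).
Proof.
have cmax : continuous (fun x : R => Num.max 0 x).
  by move=> x; apply: (@continuous_max R R (cst 0) id); [exact: cvg_cst|exact: cvg_id].
split=> [/subspace_continuousP c x|c].
  have m0 y : half (Num.max 0 y) by rewrite /= in_itv /= andbT le_max lexx.
  apply: (cvg_comp (fun y => Num.max 0 y) u) (c _ (m0 x)) => S /= wS.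
  have H : \forall y \near x, half (Num.max 0 y) -> S (Num.max 0 y) by exact: cmax x _ wS.
  by apply: filterS H => y; apply; exact: m0.
apply: (@subspace_eq_continuous _ _ _ (fun x => u (Num.max 0 x))).
  by move=> x; rewrite inE /= in_itv /= andbT => x0; rewrite /= max_r.
exact: continuous_subspaceT.
Qed.

Lemma half_shift_continuous (u : R -> R) a : 0 <= a -> {within half, continuous u} ->
  {within half, continuous (fun x => u (x + a))}.
Proof.
move=> a0 /half_continuousP c.
apply: (@subspace_eq_continuous _ _ _ (fun x => u (Num.max 0 (x + a)))).
  by move=> x; rewrite inE /= in_itv /= andbT => x0; rewrite /= max_r ?addr_ge0.
apply: continuous_subspaceT => x.
apply: (@continuous_comp _ _ _ (fun x => x + a) (fun x => u (Num.max 0 x))) (c _).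
by apply: cvgD; [exact: cvg_id|exact: cvg_cst].
Qed.

Lemma half_zext_continuous (u : R -> R) a : u 0 = 0 -> {within half, continuous u} ->
  {within half, continuous (zext a u)}.
Proof.
move=> u0 /half_continuousP c.
apply: continuous_subspaceT => x.
rewrite (_ : zext a u = (fun x => u (Num.max 0 (x - a)))).
  apply: (@continuous_comp _ _ _ (fun x => x - a) (fun x => u (Num.max 0 x))) (c _).
  by apply: cvgB; [exact: cvg_id|exact: cvg_cst].
apply/funext => y; have [ya|ay] := ltP y a.
  by rewrite zext_out// max_l// subr_le0 ltW.
by rewrite -{1}(subrK a y) zext_in ?subr_ge0// max_r ?subr_ge0.
Qed.

Lemma H1pair_shift f g a : 0 <= a -> H1pair half f g ->
  H1pair half (fun x => f (x + a)) (fun x => g (x + a)).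
Proof.
move=> a0; have S (u v : R -> R) : H1_real half u v -> H1_real half (fun x => u (x + a)) (fun x => v (x + a)).
  move=> [cu lu lv wuv]; split.
  - exact: half_shift_continuous.
  - exact: L2_shift.
  - exact: L2_shift.
  - exact: weak_shift.
by move=> [r i]; split; [exact: (S (Re \o f) (Re \o g))|exact: (S (Im \o f) (Im \o g))].
Qed.

Definition zextc a f : R -> R[i] := fun x => zext a (Re \o f) x +i* zext a (Im \o f) x.

Lemma zextc_out a f x : x < a -> zextc a f x = 0.
Proof. by move=> xa; rewrite /zextc !zext_out. Qed.

Lemma zextc_in a f x : 0 <= x -> zextc a f (x + a) = f x.
Proof. by move=> x0; rewrite /zextc !zext_in//=; case: (f x). Qed.

Lemma H1pair_zext f g a : 0 <= a -> f 0 = 0 -> H1pair half f g ->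
  H1pair half (zextc a f) (zextc a g).
Proof.
move=> a0 f0; have S (u v : R -> R) : u 0 = 0 -> H1_real half u v -> H1_real half (zext a u) (zext a v).
  move=> u0 [cu lu lv wuv]; split.
  - exact: half_zext_continuous.
  - exact: L2_zext.
  - exact: L2_zext.
  - exact: weak_zext.
by move=> [r i]; split; [apply: (S (Re \o f) (Re \o g))|apply: (S (Im \o f) (Im \o g))] => //=;
  rewrite f0.
Qed.

Lemma Lint_split q f a : 0 <= a -> measurable_fun half (fun x => normc (f x)) ->
  Lint q half f = (Lint q (`[0%R, a[%classic : set R) f + Lint q half (fun x => f (x + a)%R))%E.
Proof.
move=> a0 mf; have m := measurable_normc_powR q mf.
rewrite /Lint -(@integral_shift _ a (fun x => (normc (f x) `^ q)%:E)); last first.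
  exact: (measurable_funS _ (half_sub a0)).
have E : (half = `[0%R, a[ `|` `[a, +oo[)%classic.
  apply/seteqP; split => x /=; rewrite !in_itv /= !andbT.
    by move=> x0; case: (ltP x a) => h; [left; rewrite x0|right].
  by case=> [/andP[]//|]; exact: le_trans.
rewrite [in LHS]E (@ge0_integral_setU _ _ _ mu) //.
- by rewrite -E.
- by move=> x _; rewrite lee_fin powR_ge0.
- apply/disj_setPS => x /=; rewrite !in_itv /= andbT => -[/andP[_ xa] ax].
  by move: (lt_le_trans xa ax); rewrite ltxx.
Qed.

Lemma Lint_le q r k I f : measurable I -> measurable_fun I (fun x => normc (f x)) ->
  0 <= k -> (forall x, I x -> normc (f x) `^ q <= k * normc (f x) `^ r) ->
  (Lint q I f <= k%:E * Lint r I f)%E.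
Proof.
move=> mI mf k0 le; rewrite /Lint -(@ge0_integralZl_EFin _ _ _ mu _ mI) //.
- apply: (@ge0_le_integral _ _ _ mu _ mI) => //.
  + by move=> x _; rewrite lee_fin powR_ge0.
  + exact: measurable_normc_powR.
  + by apply: measurable_funeM; exact: measurable_normc_powR.
- by move=> x _; rewrite lee_fin powR_ge0.
- exact: measurable_normc_powR.
Qed.

Lemma ae_Lint q I f1 f2 : measurable I ->
  measurable_fun I (fun x => normc (f1 x)) -> measurable_fun I (fun x => normc (f2 x)) ->
  {ae mu, forall x, I x -> f1 x = f2 x} -> Lint q I f1 = Lint q I f2.
Proof.
move=> mI mf1 mf2 E; apply: (@ae_eq_integral _ _ _ mu) => //; try exact: measurable_normc_powR.
by apply: aeS E => x E Ix; rewrite E.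
Qed.

Lemma Lint_eq0 q I f : 0 < q -> (forall x, I x -> f x = 0) -> Lint q I f = 0%E.
Proof.
move=> q0 f0; rewrite (@eq_Lint q I f (fun=> 0) f0).
by apply: integral0_eq => x _; rewrite normc0 powR0// gt_eqF.
Qed.

(** A function bounded below in modulus by d > 0 is not square integrable on the
    half line. *)
Lemma Lint2_hits f (d : R) : measurable_fun half (fun x => normc (f x)) ->
  (Lint 2 half f < +oo)%E -> 0 < d -> exists2 x, 0 <= x & normc (f x) <= d.
Proof.
move=> mf fin d0; apply: contrapT => N.
suff : (Lint 2 half f = +oo)%E by move=> E; move: fin; rewrite E ltxx.
apply/eqP; rewrite -leye_eq.
have -> : (+oo = \int[mu]_(x in half) (d `^ 2)%:E :> \bar R)%E.
  rewrite integral_cst //= lebesgue_measure_itv /= ltry gt0_muley ?lte_fin ?powR_gt0//.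
apply: ge0_le_integral => //.
- by move=> x _; rewrite lee_fin powR_ge0.
- exact: measurable_normc_powR.
- move=> x /=; rewrite in_itv /= andbT => x0; rewrite lee_fin.
  apply: ge0_ler_powR; rewrite ?nnegrE ?normc_ge0// ?(ltW d0)//.
  by rewrite leNgt; apply/negP => lt; apply: N; exists x => //; exact: ltW.
Qed.

End Pairs.

(** * Bounds on the integrals of powers of the modulus *)

Section Plateau.
Variable R : realType.
Implicit Types (f g w v : R -> R[i]) (x y a b M : R) (I J : set R) (c d z : R[i]).
Local Notation mu := (@lebesgue_measure R).
Local Notation half := (`[0, +oo[%classic : set R).
Local Notation Re := (@complex.Re R).
Local Notation Im := (@complex.Im R).

Lemma Lint_bound q I f (C N : R) : edge_shape I -> 0 < q -> 0 <= N -> 0 <= C ->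
  measurable_fun I (fun x => normc (f x)) ->
  (forall x, I x -> normc (f x) <= C) -> (forall x, I x -> N < x -> f x = 0) ->
  (Lint q I f <= (C `^ q * N)%:E)%E.
Proof.
move=> sI q0 N0 C0 mf fC fN; have mI := edge_measurable sI.
have -> : Lint q I f = (\int[mu]_(x in I `&` `[0%R, N]) (normc (f x) `^ q)%:E)%E.
  rewrite integral_mkcondr; apply: eq_integral => x; rewrite inE => Ix.
  rewrite patchE; case: ifPn => // /negP xN; rewrite (fN x Ix).
    by rewrite normc0 powR0// gt_eqF.
  rewrite ltNge; apply/negP => xN'; apply: xN.
  by rewrite inE /= in_itv /= (edge_ge0 sI Ix).
have mIN : measurable (I `&` `[0, N]) by exact: measurableI.
apply: (@le_trans _ _ (\int[mu]_(x in I `&` `[0%R, N]) (C `^ q)%:E)%E).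
  apply: (@ge0_le_integral _ _ _ mu _ mIN) => //.
  - by move=> x _; rewrite lee_fin powR_ge0.
  - by apply: measurable_normc_powR; apply: (measurable_funS mI _ mf) => x [].
  - move=> x [Ix _]; rewrite lee_fin; apply: ge0_ler_powR; rewrite ?nnegrE ?normc_ge0//.
      exact: ltW.
    exact: fC.
rewrite integral_cst//= EFinM lee_wpmul2l ?lee_fin ?powR_ge0//.
apply: (@le_trans _ _ (mu `[0, N])).
  by apply: le_measure; rewrite ?inE//; exact: subIsetr.
rewrite /= lebesgue_measure_itv /= lte_fin; case: ifPn => _; last by rewrite lee_fin.
by rewrite oppr0 adde0.
Qed.

Lemma Lint_fin_segment q L f : 0 < q -> 0 < L ->
  {within `[0, L], continuous (Re \o f)} -> {within `[0, L], continuous (Im \o f)} ->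
  measurable_fun `[0, L] (fun x => normc (f x)) ->
  (Lint q `[0%R, L]%classic f < +oo)%E.
Proof.
move=> q0 L0 c1 c2 mf.
have c : {within `[0, L], continuous (fun x => Re (f x) ^+ 2 + Im (f x) ^+ 2)}.
  by move=> x; apply: cvgD; rewrite /GRing.exp /=; apply: cvgM;
    [exact: c1|exact: c1|exact: c2|exact: c2].
have [m _ mmax] := EVT_max (ltW L0) c.
pose C := Num.sqrt (Re (f m) ^+ 2 + Im (f m) ^+ 2).
have sI : edge_shape (`[0, L]%classic : set R) by left; exists L.
have := @Lint_bound q `[0, L]%classic f C L sI q0 (ltW L0) (sqrtr_ge0 _) mf.
move=> H; apply: le_lt_trans (H _ _) (ltry _) => x /= xI; last first.
  by move: xI; rewrite in_itv /= => /andP[_ xL] /(le_lt_trans xL); rewrite ltxx.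
have -> : normc (f x) = Num.sqrt (Re (f x) ^+ 2 + Im (f x) ^+ 2) by case: (f x).
by apply: ler_wsqrtr; exact: mmax.
Qed.

(** From s^2 <= 1 + s^q. *)
Lemma Lint2_segment (L : R) f (q : R) : 0 < L -> 2 <= q ->
  measurable_fun `[0, L] (fun x => normc (f x)) ->
  (Lint 2 `[0%R, L]%classic f <= L%:E + Lint q `[0%R, L]%classic f)%E.
Proof.
move=> L0 q2 mf; have mI : measurable (`[0, L] : set R) by exact: measurable_itv.
have -> : (L%:E = \int[mu]_(x in `[0%R, L]) 1%:E :> \bar R)%E.
  by rewrite integral_cst//= lebesgue_measure_itv /= lte_fin L0 oppr0 adde0 mul1e.
have mq := measurable_normc_powR q mf.
rewrite /Lint -(@ge0_integralD _ _ _ mu _ mI) //; last first.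
  by move=> x _; rewrite lee_fin powR_ge0.
apply: (@ge0_le_integral _ _ _ mu _ mI) => //.
- by move=> x _; rewrite lee_fin powR_ge0.
- exact: measurable_normc_powR.
- exact: emeasurable_funD.
- move=> x _; rewrite -EFinD lee_fin.
  have [n1|n1] := leP (normc (f x)) 1.
    rewrite ler_wpDr ?powR_ge0// powR_mulrn ?normc_ge0//.
    by rewrite expr_le1// normc_ge0.
  by rewrite ler_wpDl// ler_powR// ltW.
Qed.

Lemma Lint2_eq0 I f (q : R) : measurable I -> 0 < q -> measurable_fun I (fun x => normc (f x)) ->
  Lint 2 I f = 0%E -> Lint q I f = 0%E.
Proof.
move=> mI q0 mf E.
have ae : ae_eq mu I (fun x => (normc (f x) `^ 2)%:E) (cst 0%E).
  apply/(@ae_eq_integral_abs _ _ _ mu) => //; first exact: measurable_normc_powR.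
  rewrite -[RHS]E; apply: eq_integral => x _.
  by rewrite gee0_abs// lee_fin powR_ge0.
have m0 : measurable_fun I (fun x => normc ((fun=> 0 : R[i]) x)) by exact: measurable_cst.
rewrite -(@Lint_eq0 R q I (fun=> 0) q0 (fun _ _ => erefl)).
apply: (ae_Lint _ mI mf m0); apply: aeS ae => x /[apply] -[] /eqP.
by rewrite powR_eq0 => /andP[/eqP n0 _]; exact: eq0_normc.
Qed.

Definition plateau (N : R) x : R :=
  smoothstep (N^-1 * x + 1) * smoothstep (- N^-1 * x + 1).

Lemma plateau_C1 N : C1 (plateau N) /\
  derive1 (plateau N) = (fun x => smoothstep (N^-1 * x + 1) * (smoothstep' (- N^-1 * x + 1) * - N^-1)
    + smoothstep' (N^-1 * x + 1) * N^-1 * smoothstep (- N^-1 * x + 1)).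
Proof.
have [c1 d1] := C1_smoothstep N^-1 (1 : R); have [c2 d2] := C1_smoothstep (- N^-1) (1 : R).
by have [c d] := C1M c1 c2; split => //; rewrite [LHS]d d1 d2.
Qed.

Lemma plateau0 N : plateau N 0 = 1.
Proof. by rewrite /plateau !mulr0 add0r smoothstep_ge1 ?mulr1. Qed.

Lemma plateau_bound N x : `|plateau N x| <= 1.
Proof.
rewrite /plateau normrM.
have /andP[a b] := smoothstep_bound (N^-1 * x + 1).
have /andP[c d] := smoothstep_bound (- N^-1 * x + 1).
by rewrite !ger0_norm// mulr_ile1.
Qed.

Lemma plateau_out N x : 0 < N -> N < `|x| -> plateau N x = 0.
Proof.
move=> N0; rewrite ltr_normr /plateau => /orP[Nx|xN].
  rewrite [X in _ * X]smoothstep_le0 ?mulr0// -lerBrDr sub0r mulNr lerN2 ler_pdivlMl// mulr1.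
  exact: ltW.
rewrite smoothstep_le0 ?mul0r// -lerBrDr sub0r ler_pdivrMl// mulrN1.
by apply: ltW; rewrite ltrNr.
Qed.

Lemma plateau_derive_bound N x : 0 < N -> `|derive1 (plateau N) x| <= 4 / N.
Proof.
move=> N0; rewrite (plateau_C1 N).2.
have /andP[a b] := smoothstep_bound (N^-1 * x + 1).
have /andP[c d] := smoothstep_bound (- N^-1 * x + 1).
have e := smoothstep'_bound (N^-1 * x + 1).
have f := smoothstep'_bound (- N^-1 * x + 1).
have Ni : 0 < N^-1 by rewrite invr_gt0.
apply: le_trans (ler_normD _ _) _.
rewrite !normrM normrN (gtr0_norm Ni) (ger0_norm a) (ger0_norm c).
have -> : 4 / N = 1 * (2 * N^-1) + 2 * N^-1 * 1 by rewrite mul1r mulr1; lra.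
apply: lerD; apply: ler_pM => //; rewrite ?mulr_ge0 ?(ltW Ni)//.
  by rewrite ler_pM2r.
by rewrite ler_pM2r.
Qed.

(** A function of H^1 on the half line with prescribed boundary value and
    arbitrarily small Dirichlet energy. *)
Lemma plateau_H1 N z q : 0 < N -> 0 < q ->
  let f x := z * (plateau N x)%:C in let g x := z * (derive1 (plateau N) x)%:C in
  [/\ H1pair half f g, f 0 = z,
     (Lint 2 half g <= (16 * normc z `^ 2 / N)%:E)%E & (Lint q half f < +oo)%E].
Proof.
move=> N0 q0 f g; have mh : measurable half by [].
have sh : edge_shape half by exact: half_shape.
have [cp _] := plateau_C1 N.
have vp x : N < `|x| -> plateau N x = 0 by exact: plateau_out.
have hr : H1_real half (plateau N) (derive1 (plateau N)).
  split.
  - by apply: continuous_subspaceT; exact: C1_continuous.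
  - by apply: vanish_L2 vp => //; exact: C1_continuous.
  - by apply: (vanish_L2 (M := N)) => //; [exact: cp.2|exact: vanish_derive1].
  - exact: C1_weak.
have h0 : H1_real half (fun=> 0) (fun=> 0).
  have := H1_real_lin 0 0 mh hr hr.
  by congr H1_real; apply/funext => x; rewrite !mul0r addr0.
have h : H1pair half f g by apply: (H1pairZ z mh); split.
have [mf mg] := H1pair_measurable h.
have nC (r : R) : normc (z * r%:C) = normc z * `|r|.
  by rewrite normcM; congr (_ * _); rewrite /= expr0n addr0 sqrtr_sqr.
split => //.
- by rewrite /f plateau0 mulr1.
- apply: le_trans (@Lint_bound 2 half g (normc z * (4 / N)) N sh _ _ _ mg _ _) _ => //.
  + exact: ltW.
  + by rewrite mulr_ge0 ?normc_ge0// divr_ge0// ltW.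
  + by move=> x _; rewrite /g nC ler_wpM2l ?normc_ge0// plateau_derive_bound.
  + move=> x _ Nx; rewrite /g (vanish_derive1 vp) ?mulr0//.
    exact: lt_le_trans (ler_norm _).
  rewrite lee_fin powRM ?normc_ge0//; last by rewrite divr_ge0// ltW.
  rewrite [(4 / N) `^ 2]powR_mulrn; last by rewrite divr_ge0// ltW.
  by rewrite le_eqVlt; apply/orP; left; apply/eqP; field; rewrite gt_eqF.
- apply: le_lt_trans (@Lint_bound q half f (normc z) N sh _ _ _ mf _ _) (ltry _) => //.
  + exact: ltW.
  + exact: normc_ge0.
  + by move=> x _; rewrite /f nC ler_piMr ?normc_ge0// plateau_bound.
  + by move=> x _ Nx; rewrite /f vp ?mulr0//; exact: lt_le_trans (ler_norm _).
Qed.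

End Plateau.

(* Comparing two such integrals by unfolding them is very slow. *)
#[local] Opaque Lint.

(** * Minimizers on a half line *)

Section HalfMin.
Variable R : realType.
Variable p : R.
Hypothesis hp : 1 < p.
Implicit Types (f g w v : R -> R[i]) (x y a b M : R) (I J : set R) (c d z : R[i]).
Local Notation mu := (@lebesgue_measure R).
Local Notation half := (`[0, +oo[%classic : set R).
Local Notation Re := (@complex.Re R).
Local Notation Im := (@complex.Im R).

Definition half_energy f g : \bar R :=
  ((2^-1)%:E * Lint 2 half g + ((p + 1)^-1)%:E * Lint (p + 1) half f)%E.

(** Competitors are written f + w with w 0 = 0. The finiteness condition allows
    energies to be subtracted. *)
Definition half_minimizer f g :=
  [/\ H1pair half f g, (Lint (p + 1) half f < +oo)%E &
    forall w v, H1pair half w v -> w 0 = 0 ->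
      (half_energy f g <= half_energy (fun x => f x + w x)%R (fun x => g x + v x)%R)%E].

Lemma half_energy_phase c f g : H1pair half f g -> normc c = 1 ->
  half_energy (fun x => c * f x) (fun x => c * g x) = half_energy f g.
Proof.
move=> h c1; have [mf mg] := H1pair_measurable h.
have p0 : 0 <= p + 1 by rewrite addr_ge0// ltW// (lt_trans ltr01).
have mh : measurable half by [].
have two : (0 : R) <= 2 by [].
by rewrite /half_energy (LintZ c mh mg two) (LintZ c mh mf p0) c1 !powR1 !mul1e.
Qed.

Lemma half_minimizer_phase c f g : normc c = 1 -> half_minimizer f g ->
  half_minimizer (fun x => c * f x) (fun x => c * g x).
Proof.
move=> c1 [h fin min].
have mh : measurable half by [].
have c0 : c != 0 by apply/eqP => c0; move: c1; rewrite c0 normc0 => /eqP; rewrite eq_sym oner_eq0.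
have [mf mg] := H1pair_measurable h.
have p0 : 0 <= p + 1 by rewrite addr_ge0// ltW// (lt_trans ltr01).
split; first exact: H1pairZ.
  by rewrite LintZ// c1 powR1 mul1e.
move=> w v hw w0.
rewrite (half_energy_phase h c1).
have hw' := H1pairZ c^-1 mh hw.
have := min _ _ hw' _; rewrite w0 mulr0 => /(_ erefl) /le_trans; apply.
rewrite -(half_energy_phase (H1pairD mh h hw') c1).
have E (k l : R -> R[i]) :
    (fun x => c * (k x + c^-1 * l x)) = (fun x => c * k x + l x).
  by apply/funext => x; rewrite mulrDr [X in _ + X]mulrA (divff c0) mul1r.
by rewrite !E.
Qed.

(** Only X' and Y', the energies of a competitor, may be infinite. *)
Lemma ereal_cancel (x0 y0 v0 : R) (X Y X' Y' : \bar R) (r s : R) : 0 < r -> 0 < s ->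
  (0 <= X < +oo)%E -> (0 <= Y < +oo)%E ->
  (0 <= X')%E -> (0 <= Y')%E ->
  (r%:E * (x0%:E + X + v0%:E) + s%:E * (y0%:E + Y)
    <= r%:E * (x0%:E + X' + v0%:E) + s%:E * (y0%:E + Y'))%E ->
  (r%:E * X + s%:E * Y <= r%:E * X' + s%:E * Y')%E.
Proof.
have fin (Z : \bar R) : (0 <= Z < +oo)%E -> exists t, Z = t%:E.
  by move=> /andP[Z0 Zf]; exists (fine Z); rewrite fineK ?ge0_fin_numE.
move=> r0 s0 /fin[x ->] /fin[y ->] X'0 Y'0.
have NyY : (s%:E * Y' != -oo)%E by rewrite -ltNye (lt_le_trans ltNy0)// mule_ge0// lee_fin ltW.
have NyX : (r%:E * X' != -oo)%E by rewrite -ltNye (lt_le_trans ltNy0)// mule_ge0// lee_fin ltW.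
have [X'E|X'f] := eqVneq X' +oo%E.
  by move=> _; rewrite X'E gt0_muley ?lte_fin// addye// leey.
have [Y'E|Y'f] := eqVneq Y' +oo%E.
  by move=> _; rewrite Y'E gt0_muley ?lte_fin// addey// leey.
have [|x' ->] := fin X'; first by rewrite X'0 ltey.
have [|y' ->] := fin Y'; first by rewrite Y'0 ltey.
by rewrite -!EFinM -?EFinD !lee_fin; lra.
Qed.

(** If the midpoint has at least the energy of each end point, there is no
    room for the defects of convexity DA and DB. *)
Lemma ereal_midpoint (A1 A2 A B1 B2 B DA DB : \bar R) (r s : R) : 0 < r -> 0 < s ->
  (0 <= A1)%E -> (0 <= A2)%E -> (0 <= A)%E -> (0 <= B1)%E -> (0 <= B2)%E -> (0 <= B)%E ->
  (0 <= DA)%E -> (0 <= DB)%E ->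
  (A1 < +oo)%E -> (A2 < +oo)%E -> (B1 < +oo)%E -> (B2 < +oo)%E ->
  (2%:E * A + DA = A1 + A2)%E -> (2%:E * B + DB = B1 + B2)%E ->
  (r%:E * A1 + s%:E * B1 <= r%:E * A + s%:E * B)%E ->
  (r%:E * A2 + s%:E * B2 <= r%:E * A + s%:E * B)%E -> DB = 0%E.
Proof.
have fin (Z : \bar R) : (0 <= Z)%E -> (Z < +oo)%E -> exists t, Z = t%:E.
  by move=> Z0 Zf; exists (fine Z); rewrite fineK ?ge0_fin_numE.
have fin2 (Z D T : \bar R) : (0 <= Z)%E -> (0 <= D)%E -> (T < +oo)%E ->
    (2%:E * Z + D = T)%E -> (exists t, Z = t%:E) /\ (exists t, D = t%:E).
  move=> Z0 D0 Tf E; split.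
    apply: fin => //; rewrite ltey; apply/eqP => ZE; move: Tf; rewrite -E ZE.
    by rewrite gt0_muley ?lte_fin// addye ?ltxx// -ltNye (lt_le_trans ltNy0).
  apply: fin => //; rewrite ltey; apply/eqP => ZE; move: Tf; rewrite -E ZE.
  by rewrite addey ?ltxx// -ltNye (lt_le_trans ltNy0)// mule_ge0.
move=> r0 s0 A10 A20 A0 B10 B20 B0 DA0 DB0 A1f A2f B1f B2f EA EB.
have [[a aE] [da daE]] := fin2 _ _ _ A0 DA0 (lte_add_pinfty A1f A2f) EA.
have [[b bE] [db dbE]] := fin2 _ _ _ B0 DB0 (lte_add_pinfty B1f B2f) EB.
move: EA EB DA0 DB0; rewrite {}aE {}bE {}daE {}dbE.
have [a1 ->] := fin _ A10 A1f; have [a2 ->] := fin _ A20 A2f.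
have [b1 ->] := fin _ B10 B1f; have [b2 ->] := fin _ B20 B2f.
move=> [EA] [EB]; rewrite -!EFinM -?EFinD !lee_fin => DA0 DB0 h1 h2; congr (_%:E).
have h1' : r * a1 + s * b1 <= r * a + s * b := h1.
have h2' : r * a2 + s * b2 <= r * a + s * b := h2.
have rDA : 0 <= r * da by rewrite mulr_ge0// ltW.
have sDB : s * db <= 0.
  have e1 : r * (2 * a + da) = r * (a1 + a2) by rewrite EA.
  have e2 : s * (2 * b + db) = s * (b1 + b2) by rewrite EB.
  nra.
by apply/eqP; rewrite eq_le DB0 andbT; rewrite pmulr_rle0 in sDB.
Qed.

(** A perturbation of the tail, extended by zero to [0, a[, is a perturbation of
    the whole function, and the energy on [0, a[ cancels. *)
Lemma half_minimizer_shift a f g : 0 <= a -> half_minimizer f g ->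
  half_minimizer (fun x => f (x + a)) (fun x => g (x + a)).
Proof.
move=> a0 [h fin min].
have mh : measurable half by [].
have [mf mg] := H1pair_measurable h.
have q0 : 0 < p + 1 by rewrite addr_gt0// (lt_trans ltr01).
have [_ fing] := H1pair_fin mh h.
have hs := H1pair_shift a0 h.
have fin_prefix (q : R) (k : R -> R[i]) : measurable_fun half (fun x => normc (k x)) -> (Lint q half k < +oo)%E ->
    (Lint q (`[0%R, a[%classic : set R) k < +oo)%E.
  move=> mk; apply: le_lt_trans; rewrite (Lint_split q a0 mk).
  by rewrite leeDl// Lint_ge0.
have fins : (Lint (p + 1) half (fun x => f (x + a)%R) < +oo)%E.
  apply: le_lt_trans fin; rewrite (Lint_split (p + 1) a0 mf).
  by rewrite leeDr// Lint_ge0.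
split; [exact: hs|exact: fins|move=> w v hw w0].
have hW := H1pair_zext a0 w0 hw.
have W0 : zextc a w 0 = 0.
  have [a1|a1] := ltP 0 a; first by rewrite zextc_out.
  have aE : a = 0 by apply/eqP; rewrite eq_le a1 a0.
  by rewrite aE; have := @zextc_in R 0 w 0 (lexx 0); rewrite addr0 => ->.
have := min _ _ hW W0.
have hD := H1pairD mh h hW.
have [mfD mgD] := H1pair_measurable hD.
rewrite /half_energy (Lint_split (p + 1) a0 mf) (Lint_split 2 a0 mg).
rewrite (Lint_split (p + 1) a0 mfD) (Lint_split 2 a0 mgD).
have E1 (q : R) (k l : R -> R[i]) : Lint q (`[0%R, a[%classic : set R) (fun x => k x + zextc a l x) =
    Lint q (`[0%R, a[%classic : set R) k.
  apply: eq_Lint => x; rewrite /= in_itv /= => /andP[_ xa].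
  by rewrite zextc_out// addr0.
have E2 (q : R) (k l : R -> R[i]) : Lint q half (fun x => k (x + a) + zextc a l (x + a)) =
    Lint q half (fun x => k (x + a) + l x).
  apply: eq_Lint => x; rewrite /= in_itv /= andbT => x0.
  by rewrite zextc_in.
rewrite !E1 !E2.
have fin_real (q : R) (k : R -> R[i]) : measurable_fun half (fun x => normc (k x)) ->
    (Lint q half k < +oo)%E ->
    Lint q (`[0%R, a[%classic : set R) k = (fine (Lint q (`[0%R, a[%classic : set R) k))%:E.
  move=> mk fk; rewrite fineK; first exact: erefl.
  by rewrite ge0_fin_numE; [exact: (fin_prefix q k mk fk)|exact: Lint_ge0].
rewrite (fin_real 2 g mg fing) (fin_real (p + 1) f mf fin) => le.
apply: (@ereal_cancel _ _ 0); last by rewrite !adde0; exact: le.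
- by rewrite invr_gt0.
- by rewrite invr_gt0.
- by rewrite Lint_ge0; exact: (H1pair_fin mh hs).2.
- by rewrite Lint_ge0; exact: fins.
- exact: Lint_ge0.
- exact: Lint_ge0.
Qed.

Lemma powR_half_sq z q : 0 < q -> normc z `^ q = (Re z ^+ 2 + Im z ^+ 2) `^ (q / 2).
Proof.
move=> q0; rewrite -normc2 -powRrM; congr (_ `^ _); by field.
Qed.

Lemma midpoint_convex (X Y r : R) : 1 <= r -> 0 <= X -> 0 <= Y ->
  ((X + Y) / 2) `^ r <= (X `^ r + Y `^ r) / 2.
Proof.
move=> r1 X0 Y0.
have h0 : (0 : R) <= 2^-1 by lra.
have h1 : (2^-1 : R) <= 1 by lra.
have := @convex_powR R r r1 (Itv01 h0 h1) X Y.
rewrite !inE /= !in_itv /= !andbT => /(_ X0 Y0).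
rewrite convRE [X in X `^ _ <= _ -> _]convRE /= /unstable.onem.
have -> : (1 - 2^-1 : R) = 2^-1 by lra.
have E (s t : R) : 2^-1 * s + 2^-1 * t = (s + t) / 2 by lra.
by rewrite !E.
Qed.

(** Strict convexity of the q-th power of the modulus: the midpoint inequality
    for the squared modulus is strict by the parallelogram identity. *)
Lemma normc_midpoint c d q : 2 <= q ->
  let m := (2^-1)%:C * c + (2^-1)%:C * d in
  2 * normc m `^ q <= normc c `^ q + normc d `^ q /\
  (c != d -> 2 * normc m `^ q < normc c `^ q + normc d `^ q).
Proof.
move=> q2 m; have q0 : 0 < q by lra.
have r1 : 1 <= q / 2 by lra.
rewrite !(powR_half_sq _ q0) /m !ReD !ImD !ReM !ImM /= !mul0r !subr0 !addr0.
set X := Re c ^+ 2 + Im c ^+ 2; set Y := Re d ^+ 2 + Im d ^+ 2.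
set M := (X in 2 * X `^ _ <= _).
have X0 : 0 <= X by rewrite addr_ge0 ?sqr_ge0.
have Y0 : 0 <= Y by rewrite addr_ge0 ?sqr_ge0.
have M0 : 0 <= M by rewrite addr_ge0 ?sqr_ge0.
have ME : M = (X + Y) / 2 - ((Re c - Re d) ^+ 2 + (Im c - Im d) ^+ 2) / 4.
  by rewrite /M /X /Y; field.
have conv2 : 2 * ((X + Y) / 2) `^ (q / 2) <= X `^ (q / 2) + Y `^ (q / 2).
  by have := midpoint_convex r1 X0 Y0; lra.
have XY0 : 0 <= (X + Y) / 2 by lra.
have q20 : 0 < q / 2 by lra.
have MXY : M <= (X + Y) / 2 by rewrite ME gerBl divr_ge0 ?addr_ge0 ?sqr_ge0.
split.
  apply: le_trans conv2; rewrite ler_pM2l//.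
  by apply: ge0_ler_powR; rewrite ?nnegrE// ltW.
move=> cd; apply: lt_le_trans conv2; rewrite ltr_pM2l//.
apply: (gt0_ltr_powR q20); rewrite ?nnegrE//.
rewrite lt_neqAle MXY andbT; apply: contra_neq cd => E.
move: ME; set S := (Re c - Re d) ^+ 2 + (Im c - Im d) ^+ 2 => ME.
have E' : M = (X + Y) / 2 by exact: E.
have : S = 0 by move: ME; rewrite E'; lra.
rewrite /S; case: (c) => c1 c2; case: (d) => d1 d2 /= /eqP.
rewrite paddr_eq0 ?sqr_ge0// !sqrf_eq0 !subr_eq0.
by move=> /andP[/eqP -> /eqP ->].
Qed.

(** Two minimizers with the same boundary value coincide: at their midpoint the
    energy would be smaller by strict convexity. *)
Lemma half_minimizer_unique f1 g1 f2 g2 : half_minimizer f1 g1 -> half_minimizer f2 g2 ->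
  f1 0 = f2 0 -> {ae mu, forall x, half x -> f1 x = f2 x}.
Proof.
move=> [h1 fin1 min1] [h2 fin2 min2] f12.
have mh : measurable half by [].
have [mf1 mg1] := H1pair_measurable h1; have [mf2 mg2] := H1pair_measurable h2.
have q0 : 0 < p + 1 by have := hp; lra.
pose k := (2^-1)%:C : R[i].
have kk : k + k = 1 by apply/eqP; rewrite eq_complex /= addr0 eqxx andbT; apply/eqP; lra.
pose F x := k * f1 x + k * f2 x; pose G x := k * g1 x + k * g2 x.
have hF : H1pair half F G by exact: H1pair_lin.
have [mF mG] := H1pair_measurable hF.
have E1 (u1 u2 : R -> R[i]) : (fun x => u1 x + (k * u2 x + - k * u1 x)) = (fun x => k * u1 x + k * u2 x).
  by apply/funext => x; rewrite -[in X in X + _](mul1r (u1 x)) -kk; ring.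
have E2 (u1 u2 : R -> R[i]) : (fun x => u2 x + (k * u1 x + - k * u2 x)) = (fun x => k * u1 x + k * u2 x).
  by apply/funext => x; rewrite -[in X in X + _](mul1r (u2 x)) -kk; ring.
have := min1 _ _ (H1pair_lin k (- k) mh h2 h1).
rewrite E1 (E1 g1) f12 mulNr subrr => /(_ erefl) m1.
have := min2 _ _ (H1pair_lin k (- k) mh h1 h2).
rewrite E2 (E2 g1) -f12 mulNr subrr => /(_ erefl) m2.
have [_ fg1] := H1pair_fin mh h1; have [_ fg2] := H1pair_fin mh h2.
have [_ fG] := H1pair_fin mh hF.
have q2 : 2 <= p + 1 by have := hp; lra.
have DF0 x : 0 <= normc (f1 x) `^ (p + 1) + normc (f2 x) `^ (p + 1) - 2 * normc (F x) `^ (p + 1).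
  by rewrite subr_ge0; exact: (normc_midpoint _ _ q2).1.
have DG0 x : 0 <= normc (g1 x) `^ 2 + normc (g2 x) `^ 2 - 2 * normc (G x) `^ 2.
  by rewrite subr_ge0; exact: (normc_midpoint _ _ (lexx 2)).1.
have [mDF EF] := Lint_midpoint_defect mh mF mf1 mf2 DF0.
have [mDG EG] := Lint_midpoint_defect mh mG mg1 mg2 DG0.
have {EF EG} I0 := ereal_midpoint _ _ (Lint_ge0 _ _ _) (Lint_ge0 _ _ _) (Lint_ge0 _ _ _)
   (Lint_ge0 _ _ _) (Lint_ge0 _ _ _) (Lint_ge0 _ _ _) (integral_ge0 _ _) (integral_ge0 _ _)
   fg1 fg2 fin1 fin2 EG EF m1 m2.
have ae : ae_eq mu half (fun x => (normc (f1 x) `^ (p + 1) + normc (f2 x) `^ (p + 1)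
    - 2 * normc (F x) `^ (p + 1))%:E) (cst 0%E).
  apply/(@ae_eq_integral_abs _ _ _ mu) => //.
  rewrite -[RHS]I0; last 4 first.
  - by rewrite invr_gt0.
  - by rewrite invr_gt0.
  - by move=> x _; rewrite lee_fin.
  - by move=> x _; rewrite lee_fin.
  by apply: eq_integral => x _; rewrite gee0_abs// lee_fin.
apply: aeS ae => x /[apply] -[] E.
apply/eqP/negPn/negP => /(normc_midpoint _ _ q2).2.
by rewrite -subr_gt0 E ltxx.
Qed.

End HalfMin.

Section MassBound.
Variable R : realType.
Variable p : R.
Hypothesis hp : 1 < p.
Implicit Types (f g w v : R -> R[i]) (x y a b M : R) (I J : set R) (c d z : R[i]).
Local Notation mu := (@lebesgue_measure R).
Local Notation half := (`[0, +oo[%classic : set R).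
Local Notation Re := (@complex.Re R).
Local Notation Im := (@complex.Im R).

Lemma normc_continuous f : {within half, continuous (Re \o f)} ->
  {within half, continuous (Im \o f)} -> continuous (fun x => normc (f (Num.max 0 x))).
Proof.
move=> /half_continuousP c1 /half_continuousP c2 x.
rewrite (_ : (fun x => _) = (fun x => Num.sqrt (Re (f (Num.max 0 x)) ^+ 2 + Im (f (Num.max 0 x)) ^+ 2))).
  apply: (@continuous_comp _ _ _ (fun x => Re (f (Num.max 0 x)) ^+ 2 + Im (f (Num.max 0 x)) ^+ 2) (@Num.sqrt R)).
    apply: cvgD; rewrite /GRing.exp /=; apply: cvgM; [exact: c1|exact: c1|exact: c2|exact: c2].
  exact: sqrt_continuous.
by apply/funext => y; case: (f _).
Qed.

(** The infimum a of the closed set where the modulus is at most d, nonempty by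
    [Lint2_hits]; before a the modulus is above d. *)
Lemma first_hit f g (d : R) : H1pair half f g -> 0 < d -> d <= normc (f 0) ->
  exists a, [/\ 0 <= a, normc (f a) = d & forall x, 0 <= x <= a -> d <= normc (f x)].
Proof.
move=> h d0 df.
have mh : measurable half by [].
have [mf _] := H1pair_measurable h.
have [ff _] := H1pair_fin mh h.
case: h => [[c1 _ _ _] [c2 _ _ _]].
pose N x := normc (f (Num.max 0 x)).
have cN : continuous N by exact: normc_continuous.
have NE x : 0 <= x -> N x = normc (f x) by move=> x0; rewrite /N max_r.
pose S := [set x | 0 <= x /\ N x <= d].
have [s0 s00 s0d] := Lint2_hits mf ff d0.
have hS : has_inf S.
  split; first by exists s0; split => //; rewrite NE.
  by exists 0 => x [].
pose a := inf S.
have a0 : 0 <= a by apply: lb_le_inf; [exact: hS.1|move=> x []].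
have before x : 0 <= x -> x < a -> d < N x.
  move=> x0 xa; rewrite ltNge; apply/negP => Nx.
  by move: xa; rewrite ltNge => /negP; apply; apply: ge_inf; [exact: hS.2|split].
have Na : N a <= d.
  rewrite leNgt; apply/negP => dN.
  have : \forall x \near a, d < N x by exact: (cvgr_gt _ (cN a)).
  move=> /nbhs_ballP[e /= e0 be].
  have [x [x0 Nx] xa] := inf_adherent e0 hS.
  have ax : a <= x by apply: ge_inf; [exact: hS.2|split].
  have := be x; rewrite /ball /= distrC ger0_norm ?subr_ge0// ltrBlDl => /(_ xa).
  by rewrite ltNge Nx.
have Na' : d <= N a.
  rewrite leNgt; apply/negP => Nd.
  have a1 : 0 < a.
    rewrite lt_neqAle a0 andbT; apply/eqP => aE; move: Nd; rewrite -aE NE//.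
    by rewrite ltNge df.
  have : \forall x \near a, N x < d by exact: (cvgr_lt _ (cN a)).
  move=> /nbhs_ballP[e /= e0 be].
  pose x := Num.max 0 (a - e / 2).
  have xa : x < a by rewrite gt_max a1 /=; lra.
  have := be x; rewrite /ball /= ger0_norm ?subr_ge0 ?ltW// => H.
  have ax : a - e / 2 <= x by rewrite le_max lexx orbT.
  have : N x < d by apply: H; lra.
  by rewrite ltNge ltW// before// le_max lexx.
exists a; split => //; first by rewrite -NE//; apply/eqP; rewrite eq_le Na Na'.
move=> x /andP[x0]; rewrite le_eqVlt => /predU1P[->|xa]; first by rewrite -NE.
by rewrite -NE// ltW// before.
Qed.

(** If f1 0 and f2 0 have the same modulus, then f2 is a constant phase times f1. *)
Lemma half_minimizer_Lint q f1 g1 f2 g2 : 0 <= q ->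
  half_minimizer p f1 g1 -> half_minimizer p f2 g2 ->
  normc (f1 0) = normc (f2 0) -> Lint q half f1 = Lint q half f2.
Proof.
move=> q0 m1 m2 E.
have mh : measurable half by [].
have [mf1 _] := H1pair_measurable (let: And3 h _ _ := m1 in h).
have [mf2 _] := H1pair_measurable (let: And3 h _ _ := m2 in h).
have [z1|z1] := eqVneq (f1 0) 0.
  have z2 : f2 0 = 0 by apply: eq0_normc; rewrite -E z1 normc0.
  by apply: ae_Lint => //; apply: (half_minimizer_unique hp m1 m2); rewrite z1 z2.
pose c := f2 0 / f1 0.
have c1 : normc c = 1.
  have n1 : normc (f1 0) != 0 by apply: contra_neq z1; exact: eq0_normc.
  by rewrite /c normcM normcV E mulfV// -E.
have mc := half_minimizer_phase hp c1 m1.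
have [mfc _] := H1pair_measurable (let: And3 h _ _ := mc in h).
transitivity (Lint q half (fun x => c * f1 x)).
  by rewrite LintZ// c1 powR1 mul1e.
by apply: ae_Lint => //; apply: (half_minimizer_unique hp mc m2); rewrite /c divfK.
Qed.

(** The minimizer and its opposite have the same value at 0, so they coincide. *)
Lemma half_minimizer_eq0 f g q : 0 < q -> half_minimizer p f g -> f 0 = 0 ->
  Lint q half f = 0%E.
Proof.
move=> q0 m f0.
have mh : measurable half by [].
have N1 : normc (-1 : R[i]) = 1 by rewrite normcN normc1.
have mN := half_minimizer_phase hp N1 m.
have [mf _] := H1pair_measurable (let: And3 h _ _ := m in h).
have E := half_minimizer_unique hp m mN.
have m0 : measurable_fun half (fun x => normc ((fun=> 0 : R[i]) x)) by exact: measurable_cst.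
rewrite -(@Lint_eq0 R q half (fun=> 0) q0 (fun _ _ => erefl)).
apply: (ae_Lint _ mh mf m0).
rewrite f0 mulr0 in E; apply: aeS (E erefl) => x Ex Ix.
by have := Ex Ix; rewrite mulN1r => /eqP; rewrite -addr_eq0 -mulr2n mulrn_eq0 /= => /eqP.
Qed.

Theorem half_minimizer_mass (K : R) : exists C : R, forall f g,
  half_minimizer p f g -> (Lint (p + 1) half f <= K%:E)%E -> (Lint 2 half f <= C%:E)%E.
Proof.
have mh : measurable half by [].
(* f1 is the reference profile *)
have [[f1 [g1 [m1 f10]]]|N] := pselect (exists f1 g1, half_minimizer p f1 g1 /\ f1 0 != 0); last first.
  exists 0 => f g m _; rewrite (half_minimizer_eq0 _ m)//.
  by apply/eqP/negPn/negP => f0; apply: N; exists f, g.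
have h1 : H1pair half f1 g1 by case: m1.
have [mf1 _] := H1pair_measurable h1.
have [fin1 _] := H1pair_fin mh h1.
pose d := normc (f1 0).
have d0 : 0 < d by rewrite lt_def normc_ge0 andbT; apply: contra_neq f10; exact: eq0_normc.
pose k := (d `^ (p - 1))^-1.
have k0 : 0 < k by rewrite invr_gt0 powR_gt0.
pose A := fine (Lint 2 half f1).
have AE : Lint 2 half f1 = A%:E by rewrite fineK// ge0_fin_numE// Lint_ge0.
have A0 : 0 <= A by rewrite fine_ge0// Lint_ge0.
exists (k * `|K| + A) => f g m fK.
have h : H1pair half f g by case: m.
have [mf _] := H1pair_measurable h.
have [f0|f0] := eqVneq (f 0) 0.
  by rewrite (half_minimizer_eq0 _ m)// lee_fin addr_ge0// mulr_ge0// ltW.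
have nf0 : 0 < normc (f 0) by rewrite lt_def normc_ge0 andbT; apply: contra_neq f0; exact: eq0_normc.
(* either f is a tail of f1, or f1 is a tail of f *)
have [fd|df] := leP (normc (f 0)) d.
  have [a [a0 fa _]] := first_hit h1 nf0 fd.
  have ms := half_minimizer_shift hp a0 m1.
  rewrite (half_minimizer_Lint _ m ms) ?add0r//.
  apply: (@le_trans _ _ A%:E); last by rewrite lee_fin lerDr mulr_ge0// ltW.
  by rewrite -AE (Lint_split 2 a0 mf1) leeDr// Lint_ge0.
have [a [a0 fa pre]] := first_hit h d0 (ltW df).
have ms := half_minimizer_shift hp a0 m.
rewrite (Lint_split 2 a0 mf) (half_minimizer_Lint _ ms m1) ?add0r// AE EFinD leeD2r//.
have sub : `[0%R, a[%classic `<=` half by move=> x /=; rewrite !in_itv /= andbT => /andP[].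
have mfa : measurable_fun `[0%R, a[%classic (fun x => normc (f x)) by exact: (measurable_funS _ sub mf).
have := @Lint_le R 2 (p + 1) k `[0%R, a[%classic f (measurable_itv _) mfa (ltW k0).
move=> /(_ _) /le_trans; apply.
  move=> x /=; rewrite in_itv /= => /andP[x0 xa].
  have dx : d <= normc (f x) by apply: pre; rewrite x0 ltW.
  rewrite /k ler_pdivlMl ?powR_gt0//.
  rewrite (_ : p + 1 = (p - 1) + 2); last by ring.
  rewrite (@powRD _ (normc (f x)) (p - 1) 2); last by rewrite implybE (gt_eqF (lt_le_trans d0 dx)) orbT.
  rewrite ler_wpM2r ?powR_ge0//.
  apply: ge0_ler_powR; rewrite ?nnegrE ?normc_ge0 ?(ltW d0)//.
  by have := hp; lra.
rewrite EFinM lee_pmul2l ?lte_fin//.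
apply: (@le_trans _ _ K%:E); last by rewrite lee_fin ler_norm.
apply: le_trans fK; rewrite (Lint_split (p + 1) a0 mf).
by rewrite leeDl// Lint_ge0.
Qed.

End MassBound.

(** * The energy on a graph *)

Section GraphEnergy.
Variables (R : realType) (G : metric_graph R) (H : vertex_conditions G) (p : R).
Hypothesis hp : 1 < p.
Implicit Types (psi g : graph_fun G).
Local Notation mu := (@lebesgue_measure R).
Local Notation half := (`[0, +oo[%classic : set R).

Lemma edge_itv_shape (e : edge G) : edge_shape (edge_itv e).
Proof.
case: e => [e|e] /=; last exact: half_shape.
by left; exists (edge_length e) => //; exact: edge_length_gt0.
Qed.

Lemma edge_itv_measurable (e : edge G) : measurable (edge_itv e).
Proof. exact: edge_measurable (edge_itv_shape e). Qed.

Definition H1graph psi g := forall e, H1pair (edge_itv e) (psi e) (g e).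

Definition Lint_graph (q : R) psi : \bar R := (\sum_(e : edge G) Lint q (edge_itv e) (psi e))%E.

Definition vertex_energy psi : R := \sum_(v : vertex G) vertex_form H psi v.

#[local] Transparent Lint.

Lemma Lint_graph_ge0 q psi : (0 <= Lint_graph q psi)%E.
Proof. by apply: sume_ge0 => e _; exact: Lint_ge0. Qed.

Lemma Lq_norm_pow q psi : 0 < q -> (Lq_norm q psi `^ q = Lint_graph q psi)%E.
Proof.
move=> q0; rewrite -[LHS]/((Lint_graph q psi `^ q^-1) `^ q)%E -poweRrM mulVf ?gt_eqF//.
by rewrite poweRe1// Lint_graph_ge0.
Qed.

Lemma Lq_norm2_sqr psi : (Lq_norm 2 psi ^+ 2 = Lint_graph 2 psi)%E.
Proof.
rewrite -[Lq_norm 2 psi]/(Lint_graph 2 psi `^ 2^-1)%E poweR12_sqrt ?Lint_graph_ge0//.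
by rewrite sqr_sqrte// Lint_graph_ge0.
Qed.

#[local] Opaque Lint.

Lemma H1graph_weak_deriv psi : in_H1_graph psi -> H1graph psi (graph_deriv psi).
Proof. by move=> h e; apply: weak_derivP; [exact: edge_itv_measurable|exact: h]. Qed.

Lemma H1graph_in_H1 psi g : H1graph psi g -> in_H1_graph psi.
Proof.
by move=> h e; apply/(in_H1P _ (edge_itv_measurable e)); exists (g e); exact: h.
Qed.

Lemma Lint_graph_deriv psi g : H1graph psi g -> Lint_graph 2 (graph_deriv psi) = Lint_graph 2 g.
Proof.
by move=> h; apply: eq_bigr => e _; exact: weak_deriv_Lint (edge_itv_shape e) (h e).
Qed.

Lemma quad_formE psi g : H1graph psi g ->
  quad_form H psi = (Lint_graph 2 g + (vertex_energy psi)%:E)%E.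
Proof.
by move=> h; rewrite /quad_form Lq_norm2_sqr (Lint_graph_deriv h).
Qed.

(** The energy may be computed with any family of weak derivatives. *)
Lemma energyE psi g : H1graph psi g ->
  energy H p psi = ((2^-1)%:E * (Lint_graph 2 g + (vertex_energy psi)%:E)
    + ((p + 1)^-1)%:E * Lint_graph (p + 1) psi)%E.
Proof.
move=> h; rewrite /energy (quad_formE h) Lq_norm_pow//.
by have := hp; lra.
Qed.

Lemma Lint2_graph_fin psi g : H1graph psi g -> (Lint_graph 2 psi < +oo)%E /\ (Lint_graph 2 g < +oo)%E.
Proof.
move=> h; split; apply: lte_sum_pinfty => e _.
  exact: (H1pair_fin (edge_itv_measurable e) (h e)).1.
exact: (H1pair_fin (edge_itv_measurable e) (h e)).2.
Qed.

Lemma Lint_graph_real q psi : (Lint_graph q psi < +oo)%E -> exists2 a, 0 <= a & Lint_graph q psi = a%:E.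
Proof.
move=> f; exists (fine (Lint_graph q psi)); first by rewrite fine_ge0// Lint_graph_ge0.
by rewrite fineK// ge0_fin_numE// Lint_graph_ge0.
Qed.

Lemma eq_vertex_values psi psi' : (forall h, end_value psi h = end_value psi' h) ->
  (forall v, vertex_values psi v = vertex_values psi' v).
Proof. by move=> E v; apply/matrixP => i j; rewrite !mxE E. Qed.

Lemma eq_vertex_energy psi psi' : (forall h, end_value psi h = end_value psi' h) ->
  vertex_energy psi = vertex_energy psi'.
Proof.
move=> /eq_vertex_values E; apply: eq_bigr => v _.
by rewrite /vertex_form E.
Qed.

Lemma eq_form_domain psi psi' g : form_domain H psi -> H1graph psi' g ->
  (forall h, end_value psi h = end_value psi' h) -> form_domain H psi'.
Proof.
move=> [_ d] h /eq_vertex_values E; split; first exact: H1graph_in_H1 h.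
by move=> v; rewrite -E.
Qed.

Definition gscale (t : R) psi : graph_fun G := fun e x => t%:C * psi e x.

Lemma H1graph_scale t psi g : H1graph psi g -> H1graph (gscale t psi) (gscale t g).
Proof. by move=> h e; apply: H1pairZ; [exact: edge_itv_measurable|exact: h]. Qed.

Lemma vertex_values_scale t psi v :
  vertex_values (gscale t psi) v = t%:C *: vertex_values psi v.
Proof.
apply/matrixP => i j; rewrite !mxE /end_value.
by case: (enum_val i) => [[e []]|e].
Qed.

Lemma form_domain_scale t psi : form_domain H psi -> form_domain H (gscale t psi).
Proof.
move=> [h d]; split; first exact: H1graph_in_H1 (H1graph_scale t (H1graph_weak_deriv h)).
by move=> v; rewrite vertex_values_scale -scalemxAr d scaler0.
Qed.

Lemma vertex_energy_scale t psi : vertex_energy (gscale t psi) = t ^+ 2 * vertex_energy psi.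
Proof.
rewrite /vertex_energy mulr_sumr; apply: eq_bigr => v _.
rewrite /vertex_form vertex_values_scale -scalemxAr.
set w := _ *m vertex_values psi v.
rewrite linearZ /= map_mxZ; set c := (X in (X *: _) *m _).
have -> : c = t%:C by exact: conjc_real.
rewrite -!scalemxAr -scalemxAl scalerA.
set M := _ *m _; rewrite mxE.
by case: (M 0 0) => r s /=; ring.
Qed.

Lemma normc_real (t : R) : 0 <= t -> normc t%:C = t.
Proof. by move=> t0; rewrite /= expr0n addr0 sqrtr_sqr ger0_norm. Qed.

Lemma Lint_graph_scale q t psi g : 0 <= q -> 0 <= t -> H1graph psi g ->
  Lint_graph q (gscale t psi) = ((t `^ q)%:E * Lint_graph q psi)%E /\
  Lint_graph q (gscale t g) = ((t `^ q)%:E * Lint_graph q g)%E.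
Proof.
move=> q0 t0 h.
have L (u : graph_fun G) : (forall e, measurable_fun (edge_itv e) (fun x => normc (u e x))) ->
    Lint_graph q (gscale t u) = ((t `^ q)%:E * Lint_graph q u)%E.
  move=> mu_; rewrite /Lint_graph ge0_sume_distrr; last by move=> e _; exact: Lint_ge0.
  apply: eq_bigr => e _; rewrite LintZ ?normc_real//.
  exact: edge_itv_measurable.
by split; apply: L => e; have [? ?] := H1pair_measurable (h e).
Qed.

End GraphEnergy.

(** * Minimizers on a graph *)

Section Main.
Variables (R : realType) (G : metric_graph R) (H : vertex_conditions G) (p : R).
Hypothesis hp : 1 < p.
Implicit Types (psi g : graph_fun G).
Local Notation mu := (@lebesgue_measure R).
Local Notation half := (`[0, +oo[%classic : set R).
Local Notation V := (vertex_energy H).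

Let p10 : 0 < p + 1.
Proof. by have := hp; lra. Qed.

Lemma energy_real psi g a b : H1graph psi g ->
  Lint_graph 2 g = a%:E -> Lint_graph (p + 1) psi = b%:E ->
  energy H p psi = (2^-1 * (a + V psi) + (p + 1)^-1 * b)%:E.
Proof. by move=> h aE bE; rewrite (energyE H hp h) aE bE. Qed.

Lemma energy_scale t psi g a b : 0 <= t -> H1graph psi g ->
  Lint_graph 2 g = a%:E -> Lint_graph (p + 1) psi = b%:E ->
  energy H p (gscale t psi) =
    (2^-1 * (t ^+ 2 * (a + V psi)) + (p + 1)^-1 * (t `^ (p + 1) * b))%:E.
Proof.
move=> t0 h aE bE; rewrite (energy_real (H1graph_scale t h) (a := t ^+ 2 * a) (b := t `^ (p + 1) * b)).
- by rewrite vertex_energy_scale; congr (_%:E); ring.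
- by rewrite (Lint_graph_scale (ler0n _ 2) t0 h).2 aE powR_mulrn.
- by rewrite (Lint_graph_scale (ltW p10) t0 h).1 bE.
Qed.

Lemma energy_fin psi g : H1graph psi g -> (energy H p psi < +oo)%E ->
  (Lint_graph (p + 1) psi < +oo)%E.
Proof.
move=> h; rewrite (energyE H hp h) => f; rewrite ltey; apply/eqP => E; move: f; rewrite E.
have [a _ ->] := Lint_graph_real (Lint2_graph_fin h).2.
by rewrite gt0_muley ?lte_fin ?invr_gt0// addey// ltxx.
Qed.

(** On the infinite edges, replacing psi by plateaus of length N with the same
    vertex values leaves there only a Dirichlet energy of order 1 / N, so the
    quadratic form remains negative, while the L^(p+1) norm becomes finite.
    A small multiple then has negative energy since p + 1 > 2. *)
Lemma tau_min_lt0 : (l_H H < 0)%E -> (tau_min H p < 0)%E.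
Proof.
move=> /ereal_inf_lt[_ [psi [dpsi _] <-] Q0].
have hg := H1graph_weak_deriv dpsi.1.
move: Q0; set g := graph_deriv psi in hg *.
rewrite (quad_formE H hg) /Lint_graph big_sumType /=.
set S := (\sum_(e : fin_edge G) _)%E.
have S0 : (0 <= S)%E by apply: sume_ge0 => e _; exact: Lint_ge0.
have Sf : (S < +oo)%E.
  apply: lte_sum_pinfty => e _.
  exact: (H1pair_fin (edge_itv_measurable (inl e)) (hg (inl e))).2.
pose a0 := fine S.
have a0E : S = a0%:E by rewrite fineK// ge0_fin_numE.
rewrite a0E => Q0.
have A0 : a0 + V psi < 0.
  rewrite -lte_fin EFinD; apply: le_lt_trans Q0.
  by rewrite leeD2r// leeDl// sume_ge0// => e _; exact: Lint_ge0.
pose z (e : inf_edge G) := psi (inr e) 0.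
pose Z := \sum_(e : inf_edge G) 16 * normc (z e) `^ 2.
have Z0 : 0 <= Z by apply: sumr_ge0 => e _; rewrite mulr_ge0// powR_ge0.
(* the Dirichlet energy of the plateaus, at most Z / N, is then less than
   - (a0 + V psi) *)
pose N := (Z + 1) / - (a0 + V psi).
have N0 : 0 < N by rewrite divr_gt0 ?oppr_gt0// ltr_wpDl.
pose psi1 : graph_fun G := fun e => match e with
  | inl a => psi (inl a) | inr b => fun x => z b * (plateau N x)%:C end.
pose g1 : graph_fun G := fun e => match e with
  | inl a => g (inl a) | inr b => fun x => z b * (derive1 (plateau N) x)%:C end.
have P b := plateau_H1 (z b) N0 p10.
have h1 : H1graph psi1 g1.
  by move=> [a|b]; [exact: hg (inl a)|have [] := P b].
have ends h : end_value psi h = end_value psi1 h.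
  by case: h => [[e []]|e] //=; have [_ ->] := P e.
have d1 := eq_form_domain dpsi h1 ends.
have [a1 a10 a1E] := Lint_graph_real (Lint2_graph_fin h1).2.
have a1le : a1 <= a0 + Z / N.
  rewrite -lee_fin -a1E /Lint_graph big_sumType /= EFinD; apply: leeD.
    by rewrite -a0E.
  rewrite /Z mulr_suml -sumEFin; apply: lee_sum => e _.
  by have [] := P e.
have A1 : a1 + V psi1 < 0.
  rewrite -(eq_vertex_energy H ends).
  have : Z / N < - (a0 + V psi).
    by rewrite ltr_pdivrMr// /N mulrCA mulfV ?gt_eqF ?oppr_gt0// mulr1 ltrDl.
  lra.
have [b1 b10 b1E] : exists2 b, 0 <= b & Lint_graph (p + 1) psi1 = b%:E.
  apply: Lint_graph_real; apply: lte_sum_pinfty => -[e|e] _ /=; last by have [] := P e.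
  case: (dpsi.1 (inl e)) => c1 c2 _ _.
  apply: Lint_fin_segment => //; first exact: edge_length_gt0.
  exact: (H1pair_measurable (hg (inl e))).1.
pose c := - (a1 + V psi1) / 2; pose d := (p + 1)^-1 * b1.
have c0 : 0 < c by rewrite divr_gt0// oppr_gt0.
have d0 : 0 <= d by rewrite mulr_ge0// invr_ge0 ltW.
(* the scaling factor t satisfies t ^ (p - 1) = s, with d * s < c *)
pose s := c / (d + 1).
have s0 : 0 < s by rewrite divr_gt0// ltr_wpDl.
pose t := s `^ (p - 1)^-1.
have t0 : 0 < t by rewrite powR_gt0.
apply: (@le_lt_trans _ _ (energy H p (gscale t psi1))).
  by apply: ereal_inf_lbound; exists (gscale t psi1) => //; exact: form_domain_scale.
rewrite (energy_scale (ltW t0) h1 a1E b1E) lte_fin.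
have -> : t `^ (p + 1) = t ^+ 2 * s.
  rewrite (_ : p + 1 = 2 + (p - 1)); last by ring.
  rewrite (@powRD _ t 2 (p - 1)); last by rewrite (gt_eqF t0) implybT.
  rewrite powR_mulrn ?(ltW t0)//; congr (_ * _).
  by rewrite /t -powRrM mulVf ?powRr1 ?(ltW s0)// subr_eq0 gt_eqF.
have ds : d * s < c.
  rewrite /s mulrCA gtr_pMr// ltr_pdivrMr ?ltr_wpDl// mul1r ltrDl//.
have t20 : 0 < t ^+ 2 by rewrite exprn_gt0.
have -> : 2^-1 * (t ^+ 2 * (a1 + V psi1)) + (p + 1)^-1 * (t ^+ 2 * s * b1) = t ^+ 2 * (d * s - c).
  by rewrite /d /c; field; rewrite gt_eqF.
by rewrite pmulr_rlt0// subr_lt0.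
Qed.

(** With alpha + beta = tau_min, where beta is the nonlinear part of the energy
    of a minimizer psi, the energy of psi / 2 is alpha / 4 + s beta with s < 1/4;
    that it is at least tau_min bounds beta. *)
Lemma minimizer_Lint_bound : (tau_min H p < 0)%E ->
  exists K : R, 0 <= K /\ forall psi, tau_min_minimizer H p psi ->
    (Lint_graph (p + 1) psi <= K%:E)%E.
Proof.
move=> tau0; pose s := (2^-1 : R) `^ (p + 1).
have s4 : s < 4^-1.
  rewrite /s (_ : p + 1 = 2 + (p - 1)); last by ring.
  rewrite (@powRD _ 2^-1 2 (p - 1)); last by rewrite invr_eq0 pnatr_eq0 implybT.
  have h1 : (2^-1 : R) `^ (p - 1) < 1.
    have p1 : 0 < p - 1 by have := hp; lra.
    have := gt0_ltr_powR p1 (_ : (2^-1 : R) \is Num.nneg) (_ : (1 : R) \is Num.nneg).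
    rewrite powR1 !nnegrE => lt; apply: lt; rewrite ?ler01 ?invr_ge0//; lra.
  by rewrite powR_mulrn//; lra.
pose T := fine (tau_min H p).
pose K := `|(p + 1) * ((3 / 4 * - T) / (4^-1 - s))|.
exists K; split; first exact: normr_ge0.
move=> psi [dpsi E].
have hg := H1graph_weak_deriv dpsi.1.
have fE : (energy H p psi < +oo)%E by rewrite E (lt_trans tau0)// ltry.
have [a a0 aE] := Lint_graph_real (Lint2_graph_fin hg).2.
have [b b0 bE] := Lint_graph_real (energy_fin hg fE).
have TE := energy_real hg aE bE.
have : (energy H p psi <= energy H p (gscale 2^-1 psi))%E.
  by rewrite E; apply: ereal_inf_lbound; exists (gscale 2^-1 psi) => //; exact: form_domain_scale.
rewrite (energy_scale _ hg aE bE)// TE lee_fin => le.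
have T1 : T = 2^-1 * (a + V psi) + (p + 1)^-1 * b by rewrite /T -E TE.
rewrite bE lee_fin; apply: le_trans (ler_norm _).
rewrite -ler_pdivrMl// ler_pdivlMr ?subr_gt0//.
move: le; rewrite -/s T1; lra.
Qed.

(** A competitor on one infinite edge with the same value at the vertex gives a
    competitor on the graph; the contributions of the other edges and of the
    vertices cancel. *)
Lemma minimizer_half psi g (e0 : inf_edge G) : tau_min_minimizer H p psi -> H1graph psi g ->
  (energy H p psi < +oo)%E -> half_minimizer p (psi (inr e0)) (g (inr e0)).
Proof.
move=> [dpsi E] hg fE.
have bfin := energy_fin hg fE.
have le_Lint_graph q (u : graph_fun G) (e : edge G) : (Lint q (edge_itv e) (u e) <= Lint_graph q u)%E.
  rewrite /Lint_graph (bigD1 e)//= leeDl// sume_ge0// => e' _; exact: Lint_ge0.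
split; first exact: hg (inr e0).
  exact: le_lt_trans (le_Lint_graph (p + 1) psi (inr e0)) bfin.
move=> w v hw w0.
pose upd (u : graph_fun G) (k : R -> R[i]) : graph_fun G :=
  fun e => if e == inr e0 then fun x => u (inr e0) x + k x else u e.
have hu : H1graph (upd psi w) (upd g v).
  move=> e; rewrite /upd; case: eqVneq => [->|_]; last exact: hg.
  exact: (H1pairD (edge_itv_measurable (inr e0)) (hg (inr e0)) hw).
have ends h : end_value psi h = end_value (upd psi w) h.
  case: h => [[e []]|e] //=; rewrite /upd.
  by case: (eqVneq (inr e) (inr e0 : edge G)) => [->|_] //; rewrite w0 addr0.
have du := eq_form_domain dpsi hu ends.
have : (energy H p psi <= energy H p (upd psi w))%E.
  by rewrite E; apply: ereal_inf_lbound; exists (upd psi w).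
rewrite (energyE H hp hg) (energyE H hp hu) -(eq_vertex_energy H ends).
pose rest q (u : graph_fun G) : \bar R :=
  (\sum_(e : edge G | e != inr e0) Lint q (edge_itv e) (u e))%E.
have split_Lint_graph q (u : graph_fun G) : Lint_graph q u = (rest q u + Lint q half (u (inr e0)))%E.
  by rewrite addeC /Lint_graph (bigD1 (inr e0)).
have rest_upd q (u : graph_fun G) k : rest q (upd u k) = rest q u.
  by apply: eq_bigr => e /negbTE ne; rewrite /upd ne.
have upd_e0 u k : upd u k (inr e0) = fun x => u (inr e0) x + k x by rewrite /upd eqxx.
have rest_real q (u : graph_fun G) : (Lint_graph q u < +oo)%E -> exists r, rest q u = r%:E.
  move=> f; exists (fine (rest q u)); rewrite fineK; first exact: erefl.
  rewrite ge0_fin_numE; last by apply: sume_ge0 => e _; exact: Lint_ge0.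
  by apply: lte_sum_pinfty => e _; exact: le_lt_trans (le_Lint_graph q u e) f.
rewrite !split_Lint_graph !rest_upd !upd_e0.
have [x0 ->] := rest_real 2 g (Lint2_graph_fin hg).2.
have [y0 ->] := rest_real (p + 1) psi bfin.
apply: ereal_cancel.
- by rewrite invr_gt0.
- by rewrite invr_gt0.
- rewrite Lint_ge0; exact: le_lt_trans (le_Lint_graph 2 g (inr e0)) (Lint2_graph_fin hg).2.
- rewrite Lint_ge0; exact: le_lt_trans (le_Lint_graph (p + 1) psi (inr e0)) bfin.
- exact: Lint_ge0.
- exact: Lint_ge0.
Qed.

End Main.

Section Final.
Variables (R : realType) (G : metric_graph R) (H : vertex_conditions G) (p : R).
Hypothesis hp : 1 < p.
Implicit Types (psi g : graph_fun G).
Local Notation half := (`[0, +oo[%classic : set R).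

Lemma minimizer_fin psi : (tau_min H p < 0)%E -> tau_min_minimizer H p psi ->
  (energy H p psi < +oo)%E.
Proof. by move=> t0 [_ ->]; apply: lt_trans t0 _; rewrite ltry. Qed.

Lemma minimizer_mass_bound : (tau_min H p < 0)%E ->
  exists2 M : R, 0 <= M & forall psi, tau_min_minimizer H p psi -> (Lint_graph 2 psi <= M%:E)%E.
Proof.
move=> t0; have [K [K0 bK]] := minimizer_Lint_bound hp t0.
have [C bC] := half_minimizer_mass hp K.
exists (\sum_(e : fin_edge G) (edge_length e + K) + \sum_(e : inf_edge G) `|C|).
  by rewrite addr_ge0// sumr_ge0// => e _; rewrite addr_ge0// ltW// edge_length_gt0.
move=> psi m; have hg := H1graph_weak_deriv m.1.1.
have edgeK e : (Lint (p + 1) (edge_itv e) (psi e) <= K%:E)%E.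
  apply: le_trans (bK _ m); rewrite /Lint_graph (bigD1 e)//= leeDl// sume_ge0// => e' _.
  exact: Lint_ge0.
rewrite /Lint_graph big_sumType /= EFinD -!sumEFin.
apply: leeD; apply: lee_sum => e _.
  have mf := (H1pair_measurable (hg (inl e))).1.
  have p2 : 2 <= p + 1 by have := hp; lra.
  apply: le_trans (Lint2_segment (edge_length_gt0 e) p2 mf) _.
  by rewrite EFinD leeD2l// (edgeK (inl e)).
have hm := minimizer_half hp e m hg (minimizer_fin t0 m).
apply: le_trans (bC _ _ hm (edgeK (inr e))) _.
by rewrite lee_fin ler_norm.
Qed.

Lemma mass_Lint_graph psi mu : 0 <= mu -> mass psi = mu%:E -> Lint_graph 2 psi = (mu ^+ 2)%:E.
Proof. by move=> mu0 E; rewrite -Lq_norm2_sqr -/(mass psi) E -EFin_expe. Qed.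

(** If psi had mass 0, its energy would be half its quadratic form, and the
    energy of 2 psi would be 4 tau_min, which is less than tau_min. *)
Lemma minimizer_mass_gt0 psi : (tau_min H p < 0)%E -> tau_min_minimizer H p psi ->
  exists2 mu : R, 0 < mu & mass psi = mu%:E.
Proof.
move=> t0 m; have hg := H1graph_weak_deriv m.1.1.
have p10 : 0 < p + 1 by have := hp; lra.
have mass0 : (0 <= mass psi)%E by exact: poweR_ge0.
have massf : (mass psi < +oo)%E.
  by apply: poweR_lty; exact: (Lint2_graph_fin hg).1.
have massE : mass psi = (fine (mass psi))%:E by rewrite fineK// ge0_fin_numE.
exists (fine (mass psi)) => //.
rewrite lt_neqAle fine_ge0// andbT; apply/eqP => E0.
have T0 : Lint_graph 2 psi = 0%E.
  by rewrite (mass_Lint_graph (lexx 0)) ?expr0n// massE -E0.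
have B0 : Lint_graph (p + 1) psi = 0%E.
  rewrite /Lint_graph big1// => e _.
  apply: Lint2_eq0 => //; first exact: edge_itv_measurable.
    exact: (H1pair_measurable (hg e)).1.
  apply/eqP; rewrite eq_le Lint_ge0 andbT -T0 /Lint_graph (bigD1 e)//= leeDl// sume_ge0// => e' _.
  exact: Lint_ge0.
have [a _ aE] := Lint_graph_real (Lint2_graph_fin hg).2.
have : (energy H p psi <= energy H p (gscale 2 psi))%E.
  rewrite m.2; apply: ereal_inf_lbound; exists (gscale 2 psi) => //.
  exact: form_domain_scale m.1.
rewrite (energy_scale H hp (ler0n _ 2) hg aE B0) (energy_real H hp hg aE B0) lee_fin.
have := t0; rewrite -m.2 (energy_real H hp hg aE B0) lte_fin.
by lra.
Qed.

(** The mass mu of a minimizer belongs to the set whose infimum is mu_min, and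
    shows that tau attains its minimum. *)
Lemma mu_min_le_mass psi mu : tau_min_minimizer H p psi -> 0 < mu -> mass psi = mu%:E ->
  (mu_min H p <= mu%:E)%E.
Proof.
move=> [dpsi E] mu0 mE.
have le_tau nu : (tau_min H p <= tau H p nu)%E.
  by apply: ereal_inf_le_tmp => _ [u [du _] <-]; exists u.
have tauE : tau H p mu = tau_min H p.
  apply/eqP; rewrite eq_le le_tau andbT -E; apply: ereal_inf_lbound.
  by exists psi.
rewrite /mu_min; case: asboolP => [_|]; last first.
  by case; exists mu => // nu _; rewrite tauE.
by apply: ereal_inf_lbound; exists mu.
Qed.

End Final.

Theorem proposition3p14 (R : realType) (p : R) (G : metric_graph R)
    (H : vertex_conditions G)
    (hp : 1 < p)
    (Gconn : connected_graph G)
    (Ginf : (0 < #|inf_edge G|)%N)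
    (hl : (l_H H < 0)%E)
    (hmin : exists psi : graph_fun G, tau_min_minimizer H p psi) :
  exists mu2 : R,
    (mu_min H p <= mu2%:E)%E /\
    forall mu : R, mu2 < mu ->
      ~ exists psi : graph_fun G,
          tau_min_minimizer H p psi /\ mass psi = mu%:E.
Proof.
have t0 := tau_min_lt0 hp hl.
have [M M0 bM] := minimizer_mass_bound hp t0.
case: hmin => psi0 m0.
have [mu0 mu00 mE0] := minimizer_mass_gt0 hp t0 m0.
(* M bounds the square of the mass; beyond M + 1, mu is less than its square *)
exists (M + 1 + mu0); split.
  apply: le_trans (mu_min_le_mass m0 mu00 mE0) _.
  by rewrite lee_fin lerDr addr_ge0.
move=> mu muM [psi [m mE]].
have mu0' : 0 <= mu by lra.
have := bM psi m; rewrite (mass_Lint_graph mu0' mE) lee_fin.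
by nra.
Qed.
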